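(* Assume that $X_0\in L^\infty$. Then for every $\beta\in\mathbb{R}$ and $\lambda>0$, the dual optimization problem $\max_{w\in\mathscr{W}^\mathrm{icx}}\inf_{Q\in\mathscr{Q}}L(Q,w;\beta,\lambda)$ has a unique solution $w^*_{\beta,\lambda}$, which satisfies $$(w^*_{\beta,\lambda})^\prime(s)=\left(-\widehat H_{\beta,\lambda}^\prime(s)\right)^+,\quad s\in[0,1),$$ where $H_{\beta,\lambda}(s)=\int_0^s(2\beta-\lambda Q_\rho(1-t)-2Q_0(t))dt$ for $s\in[0,1]$ and $\widehat H_{\beta,\lambda}$ is the concave envelope of $H_{\beta,\lambda}$. Moreover, $(w^*_{\beta,\lambda})^\prime$ is bounded and $w^*_{\beta,\lambda}\in\mathscr{W}^\mathrm{icx}_{c,2}$.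
   Context: Setting: complete nonatomic probability space; $\rho\in L^2$ is the stochastic discount factor with $\rho>0$ a.s. and $\mathrm{Var}[\rho]>0$; $Q_X$ is the upper quantile function of $X$, $Q_0=Q_{X_0}$. $\mathscr{Q}$ is the set of increasing right-continuous $Q:[0,1)\to\mathbb{R}$ with $\int_0^1Q^2<\infty$. $\mathscr{W}^\mathrm{icx}$ is the set of increasing convex $w:[0,1]\to[0,\infty)$ with $w(0)=0$ (viewed as measures on $[0,1]$); $\mathscr{W}^\mathrm{icx}_{c,2}$ is the subset of those $w$ that are continuous on $[0,1]$ with $w'\in L^2([0,1))$. For $Q\in\mathscr{Q}$, $w\in\mathscr{W}^\mathrm{icx}$, $$L(Q,w;\beta,\lambda)=\int_0^1(Q(s)-\beta)^2ds+\lambda\int_0^1Q(s)Q_\rho(1-s)ds-\Big(\int_{[0,1]}Q\,dw-\int_{[0,1]}Q_0\,dw\Big).$$ The concave envelope $\widehat H$ of $H$ is the smallest concave function on $[0,1]$ dominating $H$; primes denote right derivatives. *)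

(* Defs.v *)
From HB Require Import structures.
From mathcomp Require Import all_boot all_order all_algebra.
From mathcomp Require Import all_classical all_reals all_analysis.
Set Implicit Arguments. Unset Strict Implicit. Unset Printing Implicit Defensive.
Import Order.TTheory GRing.Theory Num.Theory.
Import numFieldNormedType.Exports.
Local Open Scope classical_set_scope.
Local Open Scope ring_scope.

Section Defs.
Variable R : realType.

Definition I01o : set R := `[0, 1[.
Definition I01c : set R := `[0, 1].

Definition prob_complete d (T : measurableType d) (P : probability T R) :=
  forall N : set T, measurable N -> P N = 0%E ->
  forall A, A `<=` N -> measurable A.

Definition prob_nonatomic d (T : measurableType d) (P : probability T R) :=
  forall A : set T, measurable A -> (0 < P A)%E ->
  exists B : set T, [/\ measurable B, B `<=` A, (0 < P B)%E & (P B < P A)%E].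

Definition upper_quantile d (T : measurableType d) (P : probability T R)
  (X : T -> R) (s : R) : R :=
  inf [set x : R | s < fine (P [set w | X w <= x])].

Definition in_Qset (Q : R -> R) : Prop :=
  [/\ {in `[0, 1[ &, {homo Q : x y / x <= y}},
      (forall s, 0 <= s < 1 -> Q x @[x --> s^'+] --> Q s)
    & (\int[lebesgue_measure]_(x in I01o) ((Q x) ^+ 2)%:E < +oo)%E].

(* value of Q at 1: the left limit sup_{s<1} Q(s) (possibly +oo) *)
Definition Qbar (Q : R -> R) (x : R) : \bar R :=
  if x < 1 then (Q x)%:E else ereal_sup [set (Q s)%:E | s in `[0, 1[].

Definition convex_on01 (g : R -> R) : Prop :=
  forall x y t, 0 <= x <= 1 -> 0 <= y <= 1 -> 0 <= t <= 1 ->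
    g ((1 - t) * x + t * y) <= (1 - t) * g x + t * g y.

Definition concave_on01 (g : R -> R) : Prop :=
  forall x y t, 0 <= x <= 1 -> 0 <= y <= 1 -> 0 <= t <= 1 ->
    (1 - t) * g x + t * g y <= g ((1 - t) * x + t * y).

Definition in_Wicx (w : R -> R) : Prop :=
  [/\ w 0 = 0,
      {in `[0, 1] &, {homo w : x y / x <= y}},
      convex_on01 w
    & {in `[0, 1], forall s, 0 <= w s}].

Definition is_rderiv (f : R -> R) (s d : R) : Prop :=
  h^-1 * (f (s + h) - f s) @[h --> 0^'+] --> d.

Definition in_Wicx_c2 (w : R -> R) : Prop :=
  [/\ in_Wicx w,
      {within `[0, 1], continuous w}
    & exists D : R -> R,
      [/\ (forall s, 0 <= s < 1 -> is_rderiv w s (D s)),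
          measurable_fun I01o D
        & (\int[lebesgue_measure]_(x in I01o) ((D x) ^+ 2)%:E < +oo)%E]].

(* w viewed as a measure on [0,1]: the Lebesgue-Stieltjes measure of
   the cumulative function equal to 0 on (-oo,0), w on [0,1], w 1 on (1,+oo) *)
Definition wext (w : R -> R) (x : R) : R :=
  if x < 0 then 0 else if x <= 1 then w x else w 1.

Definition cumul_of (W : R -> R) : cumulative R R :=
  match pselect ({homo W : x y / x <= y} /\ right_continuous W) with
  | left h => HB.pack W (isCumulative.Build R _ R W (proj1 h) (proj2 h))
  | right _ => [the cumulative R R of @idfun R]
  end.

Definition wmeasure (w : R -> R) := lebesgue_stieltjes_measure (cumul_of (wext w)).

Definition int_dw (Q w : R -> R) : \bar R :=
  (\int[wmeasure w]_(x in I01c) Qbar Q x)%E.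

Definition Lagr (Q0 Qr : R -> R) (Q w : R -> R) (beta lambda : R) : \bar R :=
  ((\int[lebesgue_measure]_(s in I01o) ((Q s - beta) ^+ 2)%:E)
   + lambda%:E * (\int[lebesgue_measure]_(s in I01o) (Q s * Qr (1 - s))%:E)
   - (int_dw Q w - int_dw Q0 w))%E.

Definition dual_obj (Q0 Qr : R -> R) (beta lambda : R) (w : R -> R) : \bar R :=
  ereal_inf [set Lagr Q0 Qr Q w beta lambda | Q in in_Qset].

Definition dual_maximizer (Q0 Qr : R -> R) (beta lambda : R) (w : R -> R) : Prop :=
  in_Wicx w /\
  dual_obj Q0 Qr beta lambda w =
    ereal_sup [set dual_obj Q0 Qr beta lambda w' | w' in in_Wicx].

Definition Hfun (Q0 Qr : R -> R) (beta lambda : R) (s : R) : R :=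
  (\int[lebesgue_measure]_(t in `[0, s]) (2 * beta - lambda * Qr (1 - t) - 2 * Q0 t))%R.

Definition concave_envelope (H : R -> R) (s : R) : R :=
  inf [set g s | g in [set g : R -> R | concave_on01 g /\
                         {in `[0, 1], forall x, H x <= g x}]].

End Defs.

(* Main.v *)
(** Write [a s = beta - lambda * Qr (1 - s) / 2], so that [H' = 2 * (a - Q0)].  For a
    weight [w] with density [gamma], completing the square in [Q] shows that the
    inner infimum is attained at [Q = a + gamma / 2], and the dual becomes, up to a
    constant, the maximization of [- \int (gamma + H')^2 / 4]: the L^2 projection of
    [- H'] on the cone of nonnegative increasing functions, which is
    [g = (- Hhat')^+].  Indeed the residual [f = (H' + g) / 2] satisfies
    [\int_c^1 f >= (Hhat c - H c) / 2 >= 0] for every [c], with equality when a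
    superlevel set of [g] starts at [c], because [Hhat] touches [H] there.  By the
    layer-cake formula [\int f gamma >= 0] on the cone and [\int f g = 0], which
    bounds the dual value of [w] by the optimal one minus
    [\int (gamma - g)^2 / 4].  A weight with an atom at 1 is strictly worse. *)
Require Import Defs.
From HB Require Import structures.
From mathcomp Require Import all_boot all_order all_algebra.
From mathcomp Require Import all_classical all_reals all_analysis.
From mathcomp Require Import measurable_realfun ring lra.
Set Implicit Arguments. Unset Strict Implicit. Unset Printing Implicit Defensive.
Import Order.TTheory GRing.Theory Num.Theory.
Import numFieldNormedType.Exports.
Local Open Scope classical_set_scope.
Local Open Scope ring_scope.

(** * Convex functions *)

(** The point [a + gamma / 2] of the overview need not be admissible: [a] may tend to [-oo] at 0 and
    need not be right-continuous, and [gamma] is only known to be integrable. The test function is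
    therefore the right-continuous version of [max(a, - K) + min(gamma, N) / 2], at the price of an
    arbitrarily small error. Boundedness of [Q0] makes the cap harmless: for [N] large, the test
    function lies above [Q0] wherever the cap acts.

    The two ends of the interval behave differently. [H'] is bounded above on the whole interval,
    but bounded below only away from 0. This still yields the affine majorants [C * s] and
    [H 1 + C * (1 - s)] of [H], which fix the envelope at both ends and bound its slopes by [C]; the
    boundedness of the optimal density comes from there.

    Uniqueness is read off the quadratic gap. At a maximizer [\int (min(gamma, N) - g)^2] vanishes,
    and since [g <= C < N] the cap is then inactive almost everywhere, so [gamma = g]. *)

Section convex_right_derivative.
Context {R : realType}.
Implicit Types phi : R -> R.

(** Clearing denominators keeps later uses polynomial and includes the degenerate cases [y = x] and
    [y = z]. *)
Lemma convex_on01_three_points phi x y z : convex_on01 phi ->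
  0 <= x -> x < z -> x <= y <= z -> z <= 1 ->
  (z - x) * phi y <= (z - y) * phi x + (y - x) * phi z.
Proof.
move=> cphi x0 xz /andP[xy yz] z1.
have zx0 : 0 < z - x by rewrite subr_gt0.
have := cphi x z ((y - x) / (z - x)).
have -> : (1 - (y - x) / (z - x)) * x + (y - x) / (z - x) * z = y.
  by field; rewrite gt_eqF.
have h1 : 0 <= x <= 1 by lra.
have h2 : 0 <= z <= 1 by lra.
have h3 : 0 <= (y - x) / (z - x) <= 1.
  by rewrite divr_ge0 ?subr_ge0 ?(ltW xz)//= ler_pdivrMr// mul1r; lra.
move=> /(_ h1 h2 h3); rewrite -(ler_pM2l zx0) => /le_trans; apply.
rewrite le_eqVlt; apply/orP; left; apply/eqP; field.
by rewrite gt_eqF.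
Qed.

(** For convex [phi] this is the right derivative. An infimum of chord slopes is a total function,
    and its inequalities are available before any limit is shown to exist. *)
Definition rslope phi x : R :=
  inf [set (phi y - phi x) / (y - x) | y in `]x, 1]].

Variables (phi : R -> R) (C : R).
Hypothesis cphi : convex_on01 phi.
Hypothesis phi0 : forall s, 0 <= s <= 1 -> phi 0 - C * s <= phi s.

Let slope_lb x y z : 0 <= y -> y < x -> x < z -> z <= 1 ->
  (phi x - phi y) / (x - y) <= (phi z - phi x) / (z - x).
Proof.
move=> y0 yx xz z1.
have := @convex_on01_three_points phi y x z cphi y0 (lt_trans yx xz).
rewrite (ltW yx) (ltW xz) => /(_ isT z1) h.
rewrite ler_pdivrMr ?subr_gt0// mulrAC ler_pdivlMr ?subr_gt0//.
nra.
Qed.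

Let has_inf_slopes x : 0 <= x < 1 ->
  has_inf [set (phi y - phi x) / (y - x) | y in `]x, 1]].
Proof.
move=> /andP[x0 x1]; split.
  by exists ((phi 1 - phi x) / (1 - x)), 1 => //=; rewrite in_itv/= x1 lexx.
(* At 0 there is no chord on the left to bound the slopes from below; [phi0] supplies the bound
   [- C] instead. *)
have [->|xn0] := eqVneq x 0.
  exists (- C) => _ /= [y +] <-; rewrite in_itv/= => /andP[y0 y1].
  by rewrite subr0 ler_pdivlMr//; have := phi0 (s := y); rewrite y1 (ltW y0) => /(_ isT); lra.
have {xn0}x0' : 0 < x by rewrite lt_neqAle eq_sym xn0.
exists ((phi x - phi 0) / (x - 0)) => _ /= [y +] <-; rewrite in_itv/= => /andP[y0 y1].
exact: slope_lb.
Qed.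

(** For [y > x] the chord to [y] is one of the slopes in the infimum. For [y < x] convexity puts the
    chord from [y] below all of these slopes. *)
Lemma rslope_subgradient x y : 0 <= x < 1 -> 0 <= y <= 1 ->
  phi x + rslope phi x * (y - x) <= phi y.
Proof.
move=> x01 /andP[y0 y1]; have [hne hlb] := has_inf_slopes x01.
have [xy|yx|->] := ltgtP x y; last by rewrite subrr mulr0 addr0.
  have : rslope phi x <= (phi y - phi x) / (y - x).
    by apply: ge_inf => //; exists y => //=; rewrite in_itv/= xy.
  by rewrite ler_pdivlMr ?subr_gt0//; lra.
have : (phi x - phi y) / (x - y) <= rslope phi x.
  apply: lb_le_inf => // _ /= [z +] <-; rewrite in_itv/= => /andP[xz z1].
  exact: slope_lb.
rewrite ler_pdivrMr ?subr_gt0//; lra.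
Qed.

(** These are the subgradient inequalities at [x] and at [y]. Monotonicity of the slope and the
    fundamental theorem of calculus both follow from this sandwich. *)
Lemma rslope_increment x y : 0 <= x -> x <= y -> y < 1 ->
  rslope phi x * (y - x) <= phi y - phi x <= rslope phi y * (y - x).
Proof.
move=> x0 xy y1; apply/andP; split.
  have := @rslope_subgradient x y; rewrite x0 (le_lt_trans xy y1) (le_trans x0 xy) (ltW y1).
  by move=> /(_ isT isT); lra.
have := @rslope_subgradient y x; rewrite x0 (le_trans x0 xy) y1 (le_trans xy (ltW y1)).
by move=> /(_ isT isT); lra.
Qed.

Lemma rslope_nondecreasing : {in `[0, 1[ &, {homo rslope phi : x y / x <= y}}.
Proof.
move=> x y; rewrite !in_itv/= => /andP[x0 x1] /andP[y0 y1]; rewrite le_eqVlt => /predU1P[->//|xy].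
have /andP[h1 h2] := rslope_increment x0 (ltW xy) y1.
by rewrite -(@ler_pM2r _ (y - x)) ?subr_gt0// (le_trans h1 h2).
Qed.

(** By convexity the difference quotient is nondecreasing in the step [h], so its limit at [0+] is
    its infimum. *)
Lemma rslope_is_rderiv x : 0 <= x < 1 -> is_rderiv phi x (rslope phi x).
Proof.
move=> x01; have /andP[x0 x1] := x01.
have -> : rslope phi x = inf [set h^-1 * (phi (x + h) - phi x) | h in `]0, 1 - x]].
  congr inf; apply/seteqP; split=> [_ /= [y + <-]|_ /= [h + <-]]; rewrite in_itv/= => /andP[l r].
    exists (y - x); first by rewrite in_itv/= subr_gt0 l; lra.
    by rewrite subrKC mulrC.
  exists (x + h); first by rewrite in_itv/=; apply/andP; split; lra.
  by rewrite mulrC (addrC x) addrK.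
apply: (@nondecreasing_at_right_cvgr _ (fun h => h^-1 * (phi (x + h) - phi x)) 0 (BRight (1 - x))).
- by rewrite bnd_simp subr_gt0.
- move=> h k; rewrite !in_itv/= => /andP[h0 h1] /andP[k0 k1] hk.
  have := @convex_on01_three_points phi x (x + h) (x + k) cphi x0.
  have -> : x < x + k by lra.
  have -> : x <= x + h <= x + k by lra.
  have -> : x + k <= 1 by lra.
  move=> /(_ isT isT isT) H.
  rewrite ![_^-1 * _]mulrC ler_pdivrMr// mulrAC ler_pdivlMr//; nra.
- have [_ [m hm]] := has_inf_slopes x01; exists m => _ /= [h + <-].
  rewrite in_itv/= => /andP[h0 h1]; apply: hm => /=; exists (x + h).
    by rewrite in_itv/=; apply/andP; split; lra.
  by rewrite mulrC (addrC x) addrK.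
Qed.

End convex_right_derivative.

Section subdivision.
Context {R : realType}.

(** Summing over [n + 1] equal pieces of [[a, b]], the increments of [G] telescope, and
    [|F b - F a|] is at most [(G b - G a) * (b - a) / (n + 1)] for every [n]. *)
Lemma increment_bound_constant (F G : R -> R) a b : a <= b ->
  (forall s t, a <= s -> s <= t -> t <= b -> `|F t - F s| <= (G t - G s) * (t - s)) ->
  F b = F a.
Proof.
move=> ab FG; apply/eqP; rewrite -subr_eq0 -normr_le0.
apply/ler_addgt0Pr => e e0; rewrite add0r.
pose K := (G b - G a) * (b - a).
have key n : `|F b - F a| * n.+1%:R <= K.
  have n0 : 0 < n.+1%:R :> R by rewrite ltr0n.
  pose h := (b - a) / n.+1%:R.
  pose x (i : nat) := a + i%:R * h.
  have h0 : 0 <= h by rewrite divr_ge0 ?subr_ge0.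
  have xn : x n.+1 = b by rewrite /x /h; field; rewrite addrC natr1 gt_eqF.
  have x0 : x 0%N = a by rewrite /x mul0r addr0.
  have xS i : x i.+1 - x i = h by rewrite /x -natr1; ring.
  have xmono i j : (i <= j)%N -> x i <= x j.
    by move=> ij; rewrite /x lerD2l ler_wpM2r// ler_nat.
  have tel m : (m <= n.+1)%N -> `|F (x m) - F a| <= (G (x m) - G a) * h.
    elim: m => [_|m ih mn]; first by rewrite x0 !subrr normr0 mul0r.
    have := ih (ltnW mn).
    have := FG (x m) (x m.+1); rewrite -{1}x0 xmono// xmono// -{1}xn xmono//.
    move=> /(_ isT isT isT); rewrite xS => h1 h2.
    have := ler_normD (F (x m.+1) - F (x m)) (F (x m) - F a).
    rewrite addrA subrK; nra.
  have := tel n.+1 (leqnn _); rewrite xn /h mulrA ler_pdivlMr//.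
have K0 : 0 <= K.
  by apply: le_trans (key 0%N); rewrite mulr_ge0.
pose n := Num.truncn (K / e).
have : K / e < n.+1%:R by exact: truncnS_gt.
rewrite ltr_pdivrMr// => Kn.
have n0 : 0 < n.+1%:R :> R by rewrite ltr0n.
rewrite -(ler_pM2r n0) (le_trans (key n))// mulrC; exact: ltW.
Qed.

End subdivision.

(** * Integration on the unit interval *)

Section monotone_integration.
Context {R : realType}.
Notation mu := (@lebesgue_measure R).

(** The preimage of a half-line [[r, +oo[] under a monotone function is an interval. *)
Lemma nondecreasing_itv_measurable (i : interval R) (f : R -> R) :
  {in i &, {homo f : x y / x <= y}} -> measurable_fun [set` i] f.
Proof.
move=> ndf; have mi : measurable [set` i] by exact: measurable_itv.
apply: (measurability (@RGenCInfty.G R)) => [|/= _ [_] [r] -> <-].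
  exact: RGenCInfty.measurableE.
apply: is_interval_measurable => s t [si fs] [ti ft] u /andP[su ut].
have ui : u \in i.
  by have := @interval_is_interval _ i s t si ti u; apply; rewrite su ut.
split; first exact: ui.
move: fs; rewrite /= !in_itv/= !andbT => /le_trans; apply; exact: (ndf _ _ si ui su).
Qed.

Lemma bounded_integrable (A : set (measurableTypeR R)) (f : R -> R) M : measurable A ->
  (mu A < +oo)%E -> measurable_fun A f -> (forall x, A x -> `|f x| <= M) ->
  mu.-integrable A (EFin \o f).
Proof.
move=> mA Aoo mf fM; apply: measurable_bounded_integrable => //.
by exists M; split; [exact: num_real|move=> N MN x Ax /=; rewrite (le_trans (fM _ Ax))// ltW].
Qed.

Lemma lebesgue_itv_lty (b1 b2 : bool) (a b : R) :
  (mu [set` Interval (BSide b1 a) (BSide b2 b)] < +oo)%E.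
Proof. by rewrite lebesgue_measure_itv/=; case: ifPn => // _; rewrite -EFinB ltry. Qed.

Lemma nondecreasing_integrable (D : R -> R) a b :
  {in `[a, b] &, {homo D : x y / x <= y}} -> mu.-integrable `[a, b] (EFin \o D).
Proof.
move=> ndD.
apply: (@bounded_integrable _ _ (`|D a| + `|D b|)) => //.
- exact: lebesgue_itv_lty.
- exact: nondecreasing_itv_measurable.
move=> x /=; rewrite in_itv/= => /andP[ax xb].
have ab := le_trans ax xb.
have h1 : D a <= D x by apply: ndD; rewrite ?in_itv/= ?lexx ?ax.
have h2 : D x <= D b by apply: ndD; rewrite ?in_itv/= ?lexx ?ax ?ab ?andbT.
rewrite ler_norml; apply/andP; split.
  by have := ler_norm (- D a); have := normr_ge0 (D b); rewrite normrN; lra.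
by have := ler_norm (D b); have := normr_ge0 (D a); lra.
Qed.

Lemma Rintegral_itvoc_bounds (f : R -> R) s t m M : s <= t ->
  mu.-integrable `]s, t] (EFin \o f) ->
  (forall x, s < x <= t -> m <= f x <= M) ->
  m * (t - s) <= \int[mu]_(x in `]s, t]) f x <= M * (t - s).
Proof.
move=> st intf fmM.
have cst c : mu.-integrable `]s, t] (EFin \o (fun=> c : R)).
  by apply: (@bounded_integrable _ _ `|c|) => //; exact: lebesgue_itv_lty.
have E c : \int[mu]_(x in `]s, t]) c = c * (t - s).
  have -> := @Rintegral_cst _ _ _ mu `]s, t] (measurable_itv _) c.
  have := @lebesgue_measure_itv R `]s, t]; rewrite /= lte_fin => ->.
  case: ltP => [_|ts]; first by rewrite -EFinB.
  by rewrite (@le_anti _ _ s t) ?subrr ?mulr0// st ts.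
apply/andP; split; rewrite -E; apply: le_Rintegral => // x /=;
  rewrite in_itv/= => /fmM/andP[]//.
Qed.

Lemma Rintegral_itvcc_split (f : R -> R) a s t : a <= s -> s <= t ->
  mu.-integrable `[a, t] (EFin \o f) ->
  \int[mu]_(x in `[a, t]) f x =
  \int[mu]_(x in `[a, s]) f x + \int[mu]_(x in `]s, t]) f x.
Proof.
move=> as_ st intf.
by rewrite -(@Rintegral_itvB _ _ (BLeft a) (BRight t) s)// addrC subrK.
Qed.

(** On [[s, t]] both the increment of [phi] and the integral of [D] lie between [D s * (t - s)] and
    [D t * (t - s)]. Their difference is bounded by [(D t - D s) * (t - s)], so
    [increment_bound_constant] applies with [G = D]. *)
Lemma nondecreasing_FTC (D phi : R -> R) a b : a <= b ->
  {in `[a, b] &, {homo D : x y / x <= y}} ->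
  (forall s t, a <= s -> s <= t -> t <= b ->
     D s * (t - s) <= phi t - phi s <= D t * (t - s)) ->
  \int[mu]_(x in `[a, b]) D x = phi b - phi a.
Proof.
move=> ab ndD Dphi.
pose F t := phi t - \int[mu]_(x in `[a, t]) D x.
have intD t : a <= t -> t <= b -> mu.-integrable `[a, t] (EFin \o D).
  move=> at_ tb; apply: nondecreasing_integrable => x y; rewrite !in_itv/= => xa ya xy.
  by apply: ndD => //; rewrite in_itv/=; lra.
have : F b = F a.
  apply: (@increment_bound_constant _ F D) => // s t as_ st tb.
  rewrite /F (@Rintegral_itvcc_split _ _ s)//; last by apply: intD => //; exact: le_trans st.
  have /andP[h1 h2] := Dphi s t as_ st tb.
  have /andP[h3 h4] : D s * (t - s) <= \int[mu]_(x in `]s, t]) D x <= D t * (t - s).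
    apply: Rintegral_itvoc_bounds => //.
      apply: integrableS (intD t (le_trans as_ st) tb) => //.
      by apply: subset_itvr; rewrite bnd_simp.
    by move=> x /andP[sx xt]; apply/andP; split; apply: ndD; rewrite ?in_itv/=; lra.
  by rewrite ler_norml; apply/andP; split; lra.
rewrite /F set_itv1 Rintegral_set1; lra.
Qed.

End monotone_integration.

Section square_integrable.
Context {R : realType}.
Notation mu := (@lebesgue_measure R).
Notation I := (`[0, 1[%classic : set R).
Implicit Types f g : R -> R.

Lemma I01o_lty : (mu I < +oo)%E. Proof. exact: lebesgue_itv_lty. Qed.

(** Membership in L^2. Measurability of [f] is a separate clause because that of its square does not
    imply it. *)
Definition sqint f := measurable_fun I f /\ mu.-integrable I (EFin \o (fun x => f x ^+ 2)).

Notation integ f := (mu.-integrable I (EFin \o f)).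

Lemma integD f g : integ f -> integ g -> integ (fun x => f x + g x).
Proof. by move=> h1 h2; apply: (integrableD _ h1 h2). Qed.

Lemma integB f g : integ f -> integ g -> integ (fun x => f x - g x).
Proof. by move=> h1 h2; apply: (integrableB _ h1 h2). Qed.

Lemma integZ c f : integ f -> integ (fun x => c * f x).
Proof. by move=> h1; apply: (integrableZl _ c h1). Qed.

Lemma integ_measurable f : integ f -> measurable_fun I f.
Proof. by move=> /integrableP[/measurable_EFinP]. Qed.

Lemma integ_le f g : measurable_fun I f -> (forall x, I x -> `|f x| <= g x) ->
  integ g -> integ f.
Proof.
move=> mf fg; apply: le_integrable => //.
  exact/measurable_EFinP.
by move=> x Ix; rewrite /= lee_fin (le_trans (fg _ Ix))// ler_norm.
Qed.

Lemma sqint_bounded f M : measurable_fun I f -> (forall x, I x -> `|f x| <= M) ->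
  sqint f.
Proof.
move=> mf fM; split => //; apply: (@bounded_integrable _ _ _ (M ^+ 2)).
- by [].
- exact: I01o_lty.
- exact: measurable_funX.
- by move=> x Ix; rewrite normrX lerXn2r ?nnegrE ?fM// (le_trans _ (fM x Ix)).
Qed.

Lemma sqint_cst c : sqint (fun=> c).
Proof. by apply: (@sqint_bounded _ `|c|). Qed.

Lemma sqintM f g : sqint f -> sqint g -> integ (fun x => f x * g x).
Proof.
move=> [mf f2] [mg g2]; apply: integ_le (integD f2 g2).
  exact: measurable_funM.
move=> x _ /=; rewrite ler_norml; apply/andP; split.
  by have := sqr_ge0 (f x + g x); have := sqr_ge0 (f x); have := sqr_ge0 (g x); nra.
by have := sqr_ge0 (f x - g x); have := sqr_ge0 (f x); have := sqr_ge0 (g x); nra.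
Qed.

Lemma sqint_integ f : sqint f -> integ f.
Proof.
move=> sf; have := sqintM sf (sqint_cst 1).
by under [X in EFin \o X]eq_fun do rewrite mulr1.
Qed.

Lemma sqintZ c f : sqint f -> sqint (fun x => c * f x).
Proof.
move=> [mf f2]; split; first exact: measurable_funM.
by under [X in EFin \o X]eq_fun do rewrite exprMn; exact: integZ.
Qed.

Lemma sqintD f g : sqint f -> sqint g -> sqint (fun x => f x + g x).
Proof.
move=> sf sg; split; first by apply: measurable_funD; [case: sf|case: sg].
have := integD (integD (proj2 sf) (proj2 sg)) (integZ 2 (sqintM sf sg)).
by congr (integrable _ _ (EFin \o _)); apply/funext => x /=; ring.
Qed.

Lemma sqintB f g : sqint f -> sqint g -> sqint (fun x => f x - g x).
Proof.
move=> sf /(sqintZ (-1)) sg; have := sqintD sf sg.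
by under [X in sqint X]eq_fun do rewrite mulN1r.
Qed.

End square_integrable.

(** * Positivity of an integral from its superlevel sets *)

Section layers.
Context {R : realType}.
Notation mu := (@lebesgue_measure R).
Notation I := (`[0, 1[%classic : set R).

(** The sum counts the integers [k < K] with [k < x * N]; as [x * N <= K], it is the ceiling of
    [x * N]. *)
Let layer_count (N : R) (K : nat) (x : R) : 0 < N -> 0 <= x -> x <= K%:R / N ->
  x * N <= \sum_(k < K) (k%:R / N < x)%R%:R <= x * N + 1.
Proof.
move=> N0 x0; elim: K => [|K ih].
  rewrite mul0r big_ord0 => x0'.
  have -> : x = 0 by apply/eqP; rewrite eq_le x0 x0'.
  by rewrite mul0r lexx add0r ler01.
move=> xK; rewrite big_ord_recr/=; case: ltP => [Kx|xK']; last by rewrite addr0 ih.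
rewrite (eq_bigr (fun=> 1)); last first.
  move=> i _; rewrite (le_lt_trans _ Kx)// ler_pM2r ?invr_gt0// ler_nat ltnW//.
rewrite sumr_const card_ord -[X in _ <= X <= _]natrD addn1.
move: Kx xK; rewrite ltr_pdivrMr// ler_pdivlMr// -natr1; lra.
Qed.

(* Layer-cake decomposition: [g] is a uniform limit of positive combinations
   of indicators of its superlevel sets. *)
Lemma Rintegral_layers_ge0 (f g : R -> R) M :
  mu.-integrable I (EFin \o f) -> measurable_fun I g ->
  (forall x, I x -> 0 <= g x <= M) ->
  (forall u, 0 <= u -> 0 <= \int[mu]_(x in I `&` [set x | u < g x]) f x) ->
  0 <= \int[mu]_(x in I) (f x * g x).
Proof.
move=> intf mg gM lay.
have sub u : mu.-integrable I (EFin \o (fun x => f x * (u < g x)%R%:R)) /\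
    \int[mu]_(x in I) (f x * (u < g x)%R%:R) = \int[mu]_(x in I `&` [set x | u < g x]) f x.
  have E : (fun x => f x * (u < g x)%R%:R) = f \_ [set x | u < g x].
    apply/funext => x; rewrite patchE; case: ifPn => [|].
      by rewrite inE/= => ->; rewrite mulr1.
    by rewrite notin_setE/= => /negP/negbTE ->; rewrite mulr0.
  have mlay : measurable (I `&` [set x | u < g x]).
    by rewrite -preimage_itvoy; apply: mg => //; exact: measurable_itv.
  rewrite E -Rintegral_mkcondr; split => //.
  apply: integ_le (integrable_norm intf).
    rewrite -E; apply: measurable_funM; first exact: integ_measurable.
    have mi : measurable_fun I (\1_(I `&` [set x | u < g x]) : R -> R) by exact: measurable_indic.
    move: mi; apply: eq_measurable_fun => x /[!inE] Ix; rewrite indicE; congr (_%:R).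
    by case: (boolP (u < g x)) => ux; [rewrite mem_set|rewrite memNset//= => -[_ /(elimN idP)]; apply; exact: ux].
  move=> x _ /=; rewrite patchE; case: ifPn => // _; by rewrite normr0.
pose S N K x : R := \sum_(k < K) (k%:R / N < g x)%R%:R.
have SK N K : 0 < N -> mu.-integrable I (EFin \o (fun x => f x * S N K x)) /\
    0 <= \int[mu]_(x in I) (f x * S N K x).
  move=> N0; elim: K => [|K [ih1 ih2]].
    have E x : f x * S N 0%N x = 0 by rewrite /S big_ord0 mulr0.
    under [X in EFin \o X]eq_fun do rewrite E.
    under eq_Rintegral do rewrite E.
    split; first exact: (integrable0 _ _).
    by rewrite Rintegral_ge0.
  have [h1 h2] := sub (K%:R / N).
  have E x : f x * S N K.+1 x = f x * S N K x + f x * (K%:R / N < g x)%R%:R.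
    by rewrite /S big_ord_recr/= mulrDr.
  under [X in EFin \o X]eq_fun do rewrite E.
  under eq_Rintegral do rewrite E.
  split; first exact: integD.
  by rewrite RintegralD// h2 addr_ge0// lay// divr_ge0// ltW.
have mem0 : I 0 by rewrite /= in_itv/= lexx ltr01.
have mM : 0 <= M by have /andP[h1 h2] := gM 0 mem0; exact: le_trans h2.
have inf_ : mu.-integrable I (EFin \o (fun x => `|f x|)) := integrable_norm intf.
set A := \int[mu]_(x in I) `|f x| in inf_ *.
have A0 : 0 <= A by rewrite Rintegral_ge0.
have intfg : mu.-integrable I (EFin \o (fun x => f x * g x)).
  apply: integ_le (integZ M inf_); first by apply: measurable_funM => //; exact: integ_measurable.
  move=> x Ix /=; rewrite normrM mulrC ler_wpM2r//; have /andP[g0 gx] := gM x Ix.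
  by rewrite ger0_norm.
apply/ler_addgt0Pr => e e0.
(* The layer sum differs from [N * g] by at most 1, which costs at most [A] after integration
   against [f]. Dividing by [N] leaves an error [A / N < e]. The number [K] of layers is taken so
   large that they reach [M]. *)
pose N : R := (A + 1) / e.
have N0 : 0 < N by rewrite divr_gt0// ltr_wpDl.
pose K := (Num.truncn (M * N)).+1.
have [SK1 SK2] := SK N K N0.
suff : \int[mu]_(x in I) (f x * S N K x) <= \int[mu]_(x in I) (N * (f x * g x) + `|f x|).
  rewrite RintegralD//; last exact: integZ.
  rewrite RintegralZl// => /(le_trans SK2) h.
  have : 0 <= N * (\int[mu]_(x in I) (f x * g x) + e).
    have NE : N * e = A + 1 by rewrite /N divfK ?gt_eqF.
    by rewrite mulrDr NE (le_trans h)// lerD2l /A lerDl.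
  by rewrite pmulr_rge0.
apply: le_Rintegral => //.
  by apply: integD => //; exact: integZ.
move=> x Ix; have /andP[g0 gx] := gM x Ix.
have /andP[h1 h2] : g x * N <= S N K x <= g x * N + 1.
  apply: layer_count => //; rewrite ler_pdivlMr//; apply: le_trans (ltW (truncnS_gt _)).
  by rewrite ler_pM2r.
have [f0|f0] := leP 0 (f x).
  by rewrite ger0_norm//; nra.
by rewrite ltr0_norm//; nra.
Qed.
End layers.

(** * Right-continuous versions of bounded increasing functions *)

Section right_continuous_version.
Context {R : realType}.
Notation mu := (@lebesgue_measure R).
Variables (q : R -> R) (B : R).
Hypothesis ndq : {in `]0, 1[ &, {homo q : x y / x <= y}}.
Hypothesis qB : forall x, 0 < x < 1 -> `|q x| <= B.

(** The right limit of the monotone [q]. The infimum over []s, 1[] also gives a value at 0, where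
    nothing is assumed about [q]. *)
Definition rcv (s : R) : R := inf (q @` `]s, 1[).

Let hlb s : 0 <= s < 1 -> has_inf (q @` `]s, 1[).
Proof.
move=> /andP[s0 s1]; split.
  by exists (q ((s + 1) / 2)), ((s + 1) / 2) => //=; rewrite in_itv/=; lra.
exists (- B) => _ /= [x + <-]; rewrite in_itv/= => /andP[sx x1].
by have := qB (x := x); rewrite ler_norml (le_lt_trans s0 sx) x1 => /(_ isT)/andP[].
Qed.

Lemma rcv_le s t : 0 <= s -> s < t -> t < 1 -> rcv s <= q t.
Proof.
move=> s0 st t1; apply: ge_inf; first by apply: (hlb _).2; rewrite s0 (lt_trans st t1).
by exists t => //=; rewrite in_itv/= st.
Qed.

Lemma rcv_lb s m : 0 <= s < 1 -> (forall t, s < t < 1 -> m <= q t) -> m <= rcv s.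
Proof.
move=> s01 mq; apply: lb_le_inf; first exact: (hlb s01).1.
by move=> _ /= [t + <-]; rewrite in_itv/= => /mq.
Qed.

Lemma rcv_ge s : 0 < s < 1 -> q s <= rcv s.
Proof.
move=> /andP[s0 s1]; apply: rcv_lb; first by rewrite ltW.
by move=> t /andP[st t1]; apply: ndq; rewrite ?in_itv/= ?s0 ?(lt_trans s0 st)// ltW.
Qed.

Lemma rcv_nondecreasing : {in `[0, 1[ &, {homo rcv : x y / x <= y}}.
Proof.
move=> x y; rewrite !in_itv/= => /andP[x0 x1] /andP[y0 y1] xy.
apply: rcv_lb; first by rewrite y0.
by move=> t /andP[yt t1]; apply: rcv_le => //; exact: le_lt_trans yt.
Qed.

Lemma rcv_right_continuous s : 0 <= s < 1 -> rcv x @[x --> s^'+] --> rcv s.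
Proof.
move=> s01; have /andP[s0 s1] := s01; apply/cvgrPdist_lt => e e0.
have [_ /= [t + <-]] : exists2 y, (q @` `]s, 1[) y & y < rcv s + e.
  by apply: inf_adherent => //; exact: hlb.
rewrite in_itv/= => /andP[st t1] qt.
near=> x.
have sx : s < x by near: x; exact: nbhs_right_gt.
have xt : x < t by near: x; exact: nbhs_right_lt.
have h1 : rcv s <= rcv x.
  by apply: rcv_nondecreasing; rewrite ?in_itv/= ?s0 ?s1 ?(le_trans s0 (ltW sx)) ?(lt_trans xt t1) ?(ltW sx).
have h2 : rcv x <= q t by apply: rcv_le => //; rewrite (le_trans s0)// ltW.
by rewrite ler0_norm; lra.
Unshelve. all: by end_near. Qed.

Lemma rcv_bounded s : 0 <= s < 1 -> `|rcv s| <= B.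
Proof.
move=> s01; have /andP[s0 s1] := s01; rewrite ler_norml; apply/andP; split.
  apply: rcv_lb => // t /andP[st t1].
  by have := qB (x := t); rewrite ler_norml (le_lt_trans s0 st) t1 => /(_ isT)/andP[].
have h : s < (s + 1) / 2 by lra.
have h1 : (s + 1) / 2 < 1 by lra.
apply: le_trans (rcv_le s0 h h1) _.
by apply: le_trans (ler_norm _) (qB _); lra.
Qed.

(** A point of []0, 1[] where the two functions differ yields a gap []q x, rcv x[] containing a
    rational. Gaps of distinct points are disjoint since [rcv x <= q y] for [x < y], so these points
    are countable; 0 is added to the null set. *)
Lemma rcv_ae : {ae mu, forall x, `[0, 1[%classic x -> rcv x = q x}.
Proof.
pose A := [set x | 0 < x < 1 /\ q x < rcv x].
have cA : countable A.
  pose g (r : rat) := xget 0 [set x | A x /\ q x < ratr r < rcv x].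
  apply: (@sub_countable _ _ A (g @` setT)); last exact: card_le_trans (card_image_le _ _) (countableP _).
  apply: subset_card_le => x Ax; have [x01 qr] := Ax.
  have [r] := rat_in_itvoo qr; rewrite in_itv/= => rx; exists r => //; rewrite /g.
  case: xgetP => [y _ [[y01 qy] /andP[ry1 ry2]]|/(_ x)]; last by case.
  move: rx => /andP[rx1 rx2]; have /andP[x0 x1] := x01; have /andP[y0 y1] := y01.
  have [xy|yx|//] := ltgtP x y.
    by have := rcv_le (ltW x0) xy y1; lra.
  by have := rcv_le (ltW y0) yx x1; lra.
exists (A `|` [set 0]); split.
- by apply: measurableU => //; exact: countable_measurable.
- rewrite null_set_setU//; [exact: countable_measurable|exact: countable_lebesgue_measure0|].
  exact: lebesgue_measure_set1.
move=> x /= /not_implyP[]; rewrite /= in_itv/= => /andP[x0 x1] qx.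
have [->|xn0] := eqVneq x 0; [by right|left].
have x0' : 0 < x by rewrite lt_neqAle eq_sym xn0.
split; first by rewrite x0'.
rewrite lt_neqAle rcv_ge ?x0'// andbT; apply/eqP => qe; exact: qx.
Qed.

Lemma rcv_in_Qset : in_Qset rcv.
Proof.
split; [exact: rcv_nondecreasing|exact: rcv_right_continuous|].
have [] : sqint rcv.
  apply: (@sqint_bounded _ _ B); last by move=> x; rewrite /= in_itv/= => /rcv_bounded.
  by apply: nondecreasing_itv_measurable; exact: rcv_nondecreasing.
move=> _ /integrableP[_]; congr (_ < _)%E; apply: eq_integral => x _.
by rewrite /= ger0_norm// sqr_ge0.
Qed.

End right_continuous_version.

(** * Increasing convex weights as measures *)

Section density.
Context {R : realType}.
Local Open Scope ereal_scope.
Notation mu := (@lebesgue_measure R).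
Variable h : measurableTypeR R -> \bar R.
Hypothesis mh : measurable_fun setT h.
Hypothesis h0 : forall x, 0 <= h x.
Hypothesis hoo : \int[mu]_x h x < +oo.

(** The proofs about [h] are arguments of the set function so that the measure structures declared
    below can be inferred from the term. *)
Definition density of measurable_fun setT h & (forall x, 0 <= h x) &
    \int[mu]_x h x < +oo :=
  fun A : set (measurableTypeR R) => \int[mu]_(x in A) h x.

Local Notation nu := (density mh h0 hoo).

Let nu0 : nu set0 = 0. Proof. by rewrite /density integral_set0. Qed.

Let nu_ge0 A : 0 <= nu A. Proof. by apply: integral_ge0 => x _; exact: h0. Qed.

Let nu_sigma_additive : semi_sigma_additive nu.
Proof. exact: semi_sigma_additive_nng_induced. Qed.

HB.instance Definition _ :=
  isMeasure.Build _ _ _ nu nu0 nu_ge0 nu_sigma_additive.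

Let nu_fin : fin_num_fun nu.
Proof.
move=> A mA; rewrite ge0_fin_numE//; apply: le_lt_trans hoo.
exact: ge0_subset_integral.
Qed.

HB.instance Definition _ := Measure_isFinite.Build _ _ _ nu nu_fin.

Let nu_mu : nu `<< mu.
Proof.
apply/null_content_dominatesP => A mA A0; rewrite /density.
by rewrite null_set_integral//; exact: measurable_funTS.
Qed.

(** By uniqueness [h] is almost everywhere the Radon-Nikodym derivative of [nu], for which the
    change of variables is known. *)
Lemma ge0_integral_density (f : measurableTypeR R -> \bar R) E : measurable E ->
  (forall x, 0 <= f x) -> measurable_fun E f ->
  \int[nu]_(x in E) f x = \int[mu]_(x in E) (f x * h x).
Proof.
move=> mE f0 mf.
rewrite -(Radon_Nikodym_SigmaFinite.change_of_variables nu_mu f0 mE mf).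
have RNint := Radon_Nikodym_SigmaFinite.f_integrable nu_mu.
have mRN := measurable_int _ RNint.
apply: ae_eq_integral => //.
- by apply: emeasurable_funM => //; exact: measurable_funTS.
- by apply: emeasurable_funM => //; exact: measurable_funTS.
have : ae_eq mu setT (Radon_Nikodym_SigmaFinite.f nu mu) h.
  apply: integral_ae_eq => // A _ mA.
  by rewrite -(Radon_Nikodym_SigmaFinite.f_integral nu_mu mA).
by apply: filterS => x /= + Ex => ->.
Qed.

Lemma integral_density (f : measurableTypeR R -> \bar R) E : measurable E ->
  measurable_fun E f ->
  \int[nu]_(x in E) f x = \int[mu]_(x in E) (f x * h x).
Proof.
move=> mE mf; rewrite integralE [RHS]integralE.
rewrite !ge0_integral_density//; last 2 first.
- exact: measurable_funeneg.
- exact: measurable_funepos.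
congr (_ - _); apply: eq_integral => x _.
  rewrite !funeposE; have [fx|/ltW fx] := leP 0 (f x).
    by rewrite !max_l// mule_ge0.
  by rewrite !max_r// ?mul0e// mule_le0_ge0.
rewrite !funenegE; have [fx|/ltW fx] := leP 0 (f x).
  by rewrite !max_r ?mul0e// oppe_le0// mule_ge0.
by rewrite !max_l ?mulNe// oppe_ge0// mule_le0_ge0.
Qed.

End density.

Section wicx.
Context {R : realType}.
Notation mu := (@lebesgue_measure R).
Notation I := (`[0, 1[%classic : set R).
Variable w : R -> R.
Hypothesis Ww : in_Wicx w.

Let w0 : w 0 = 0. Proof. by case: Ww. Qed.
Let ndw : {in `[0, 1] &, {homo w : x y / x <= y}}. Proof. by case: Ww. Qed.
Let cw : convex_on01 w. Proof. by case: Ww. Qed.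
Let w_ge0 : {in `[0, 1], forall s, 0 <= w s}. Proof. by case: Ww. Qed.

Let w_lb s : 0 <= s <= 1 -> w 0 - 0 * s <= w s.
Proof. by move=> s01; rewrite mul0r subr0 w0; apply: w_ge0; rewrite in_itv. Qed.

Lemma wicx_rslope_ge0 x : 0 <= x < 1 -> 0 <= rslope w x.
Proof.
move=> /andP[x0 x1]; apply: lb_le_inf.
  by exists ((w 1 - w x) / (1 - x)), 1 => //=; rewrite in_itv/= x1 lexx.
move=> _ /= [y + <-]; rewrite in_itv/= => /andP[xy y1].
rewrite divr_ge0// subr_ge0; last exact: ltW.
by apply: ndw; rewrite ?in_itv/=; lra.
Qed.

Lemma wicx_rslope_nondecreasing : {in `[0, 1[ &, {homo rslope w : x y / x <= y}}.
Proof. exact: rslope_nondecreasing cw w_lb. Qed.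

Lemma wicx_rslope_measurable : measurable_fun I (rslope w).
Proof. exact: nondecreasing_itv_measurable wicx_rslope_nondecreasing. Qed.

Lemma wicx_rslope_integrable_itv x : x < 1 ->
  mu.-integrable `[0, x] (EFin \o rslope w).
Proof.
move=> x1; apply: nondecreasing_integrable => s t; rewrite !in_itv/= => s01 t01.
by apply: wicx_rslope_nondecreasing; rewrite in_itv/=; lra.
Qed.

Lemma wicx_FTC x : 0 <= x < 1 -> \int[mu]_(t in `[0, x]) rslope w t = w x.
Proof.
move=> /andP[x0 x1]; rewrite (@nondecreasing_FTC _ _ w)// ?w0 ?subr0//.
  move=> s t; rewrite !in_itv/= => s01 t01.
  by apply: wicx_rslope_nondecreasing; rewrite in_itv/=; lra.
by move=> s t s0 st tx; apply: (rslope_increment cw w_lb) => //; lra.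
Qed.

Let w_le1 x : 0 <= x <= 1 -> w x <= w 1.
Proof. by move=> x01; apply: ndw; rewrite ?in_itv/=; lra. Qed.

(** Monotone convergence along [[0, 1 - 1/(n+1)]], on which the integral is the value of [w] at the
    right end. Equality may fail, because [w] may jump at 1. *)
Lemma wicx_rslope_integral_le : (\int[mu]_(x in I) (rslope w x)%:E <= (w 1)%:E)%E.
Proof.
pose F n : set R := `[0, 1 - n.+1%:R^-1]%classic.
have IF : I = \bigcup_n F n.
  apply/seteqP; split=> [x /=|x [n _]]; rewrite /F/= !in_itv/= => /andP[x0 x1].
    exists (Num.truncn (1 - x)^-1); first by []; rewrite /F/= in_itv/= x0/= lerBrDl -lerBrDr.
    rewrite invf_ple ?posrE ?subr_gt0//; exact: ltW (truncnS_gt _).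
  by rewrite x0 (le_lt_trans x1)// ltrBlDr ltrDl invr_gt0.
have Fsub n : F n `<=` I by rewrite IF; exact: bigcup_sup.
have cvgF : (\int[mu]_(x in F n) (rslope w x)%:E @[n --> \oo] -->
    \int[mu]_(x in \bigcup_n F n) (rslope w x)%:E)%E.
  apply: ge0_nondecreasing_set_cvg_integral => //.
  - apply/nondecreasing_seqP => n; apply/subsetPset; apply: subset_itvl.
    rewrite bnd_simp lerD2l lerN2 lef_pV2 ?posrE// ler_nat//.
  - by move=> n; exact: measurable_itv.
  - move=> n; apply/measurable_EFinP.
    by apply: measurable_funS (Fsub n) wicx_rslope_measurable.
  - move=> n x /Fsub; rewrite /= in_itv/= lee_fin; exact: wicx_rslope_ge0.
rewrite IF -(cvg_lim _ cvgF)//; apply: lime_le; first by apply/cvg_ex; eexists; exact: cvgF.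
apply: nearW => n; pose x : R := 1 - n.+1%:R^-1.
have x1 : x < 1 by rewrite /x ltrBlDr ltrDl invr_gt0.
have x0 : 0 <= x by rewrite /x subr_ge0 invf_le1// ler1n.
have -> : (\int[mu]_(t in F n) (rslope w t)%:E)%E = (w x)%:E.
  rewrite -wicx_FTC ?x0// /Rintegral fineK//.
  exact: integrable_fin_num (wicx_rslope_integrable_itv x1).
by rewrite lee_fin w_le1// x0 ltW.
Qed.

Lemma wicx_rslope_integrable : mu.-integrable I (EFin \o rslope w).
Proof.
apply/integrableP; split; first by apply/measurable_EFinP; exact: wicx_rslope_measurable.
apply: le_lt_trans (ltry (w 1)); apply: le_trans wicx_rslope_integral_le.
rewrite le_eqVlt; apply/orP; left; apply/eqP; apply: eq_integral => x.
by rewrite inE/= in_itv/= => /wicx_rslope_ge0 g0; rewrite ger0_norm.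
Qed.

(** The mass of the atom at 1: a convex increasing [w] with [w 0 = 0] can be discontinuous at no
    other point. *)
Definition wjump (w : R -> R) : R := w 1 - \int[mu]_(x in `[0, 1[) rslope w x.

Lemma wjump_ge0 : 0 <= wjump w.
Proof.
rewrite subr_ge0 -lee_fin fineK; first exact: wicx_rslope_integral_le.
exact: integrable_fin_num wicx_rslope_integrable.
Qed.

Lemma wext_nondecreasing : {homo wext w : x y / x <= y}.
Proof.
move=> x y xy; rewrite /wext.
have w1 : 0 <= w 1 by apply: w_ge0; rewrite in_itv/= lexx ler01.
case: (ltP x 0) => x0; case: (ltP y 0) => y0 //; case: (leP y 1) => y1 //.
- by apply: w_ge0; rewrite in_itv/= y0.
- by lra.
- by lra.
- by rewrite (le_trans xy y1); apply: ndw; rewrite ?in_itv/=; lra.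
- by case: (leP x 1) => x1//; apply: w_le1; lra.
Qed.

Lemma wext_right_continuous : right_continuous (wext w).
Proof.
move=> x; apply/cvgrPdist_lt => e e0.
have [x0|x0] := ltP x 0.
  near=> y; have y0 : y < 0 by near: y; exact: nbhs_right_lt.
  by rewrite /wext x0 y0 subrr normr0.
have [x1|x1] := leP 1 x.
  near=> y; have xy : x < y by near: y; exact: nbhs_right_gt.
  have nx : (x < 0) = false by rewrite ltNge x0.
  have ny : (y < 0) = false by rewrite ltNge (le_trans x0 (ltW xy)).
  rewrite /wext nx ny.
  have -> : (y <= 1) = false by apply/negbTE; rewrite -ltNge; lra.
  case: (leP x 1) => x1'; last by rewrite subrr normr0.
  have -> : x = 1 by lra.
  by rewrite subrr normr0.
(* On [[x, c]] the slope at [c] is a Lipschitz constant for [w]; adding 1 makes it positive, so that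
   [e / k] is a valid radius. *)
pose c := (x + 1) / 2; pose k := rslope w c + 1.
have k0 : 0 < k by rewrite ltr_wpDl// wicx_rslope_ge0// /c; lra.
near=> y.
have xy : x < y by near: y; exact: nbhs_right_gt.
have yc : y < c by near: y; apply: nbhs_right_lt; rewrite /c; lra.
have ye : y < x + e / k by near: y; apply: nbhs_right_lt; rewrite ltrDl divr_gt0.
have c1 : c < 1 by rewrite /c; lra.
have y0 : 0 <= y by lra.
have nx : (x < 0) = false by rewrite ltNge x0.
have ny : (y < 0) = false by rewrite ltNge y0.
rewrite /wext nx ny (ltW x1) (ltW (lt_trans yc c1)).
have /andP[h1 h2] := rslope_increment cw w_lb x0 (ltW xy) (lt_trans yc c1).
have h3 : w x <= w y by apply: ndw; rewrite ?in_itv/=; lra.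
have h4 : rslope w y <= rslope w c by apply: wicx_rslope_nondecreasing; rewrite ?in_itv/=; lra.
have h5 : (y - x) * k < e by rewrite -ltr_pdivlMr//; lra.
rewrite ler0_norm; last by lra.
rewrite opprB (le_lt_trans h2)// (le_lt_trans _ h5)// mulrC ler_wpM2l//; first lra.
by rewrite /k; lra.
Unshelve. all: by end_near. Qed.

Lemma cumul_of_wext : cumul_of (wext w) = wext w :> (R -> R).
Proof.
rewrite /cumul_of; case: pselect => // -[].
by split; [exact: wext_nondecreasing|exact: wext_right_continuous].
Qed.

Let h : measurableTypeR R -> \bar R := (EFin \o rslope w) \_ `[0, 1[.

Let mh : measurable_fun setT h.
Proof.
apply: (@measurable_restrictT _ _ _ _ _ _ (measurable_itv _)).1.
exact: (measurable_int _ wicx_rslope_integrable).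
Qed.

Let h_ge0 x : (0 <= h x)%E.
Proof.
rewrite /h patchE; case: ifPn => //; rewrite inE/= in_itv/= lee_fin.
exact: wicx_rslope_ge0.
Qed.

Let h_lty : (\int[mu]_x h x < +oo)%E.
Proof.
rewrite -integral_mkcond; exact: le_lt_trans wicx_rslope_integral_le (ltry _).
Qed.

Let nu1 := density mh h_ge0 h_lty.
(** The measure of [w] written explicitly: an absolutely continuous part on [[0, 1[] and an atom at
    1. *)
Let nu : {measure set (measurableTypeR R) -> \bar R} := measure_add nu1 (mscale (NngNum wjump_ge0) (\d_ (1%R : measurableTypeR R))).

Let nu1E A : nu1 A = (\int[mu]_(x in A `&` I) (rslope w x)%:E)%E.
Proof. by rewrite integral_mkcondr. Qed.

Let nuE A : nu A = (nu1 A + (wjump w)%:E * \d_ (1%R : measurableTypeR R) A)%E.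
Proof. exact: measure_addE. Qed.

Let nu_cdf (x : R) : nu `]-oo, x]%classic = (wext w x)%:E.
Proof.
rewrite nuE nu1E /wext diracE.
have [x0|x0] := ltP x 0.
  rewrite memNset ?mule0 ?adde0; last by rewrite /= in_itv/= => x1; lra.
  rewrite (_ : _ `&` _ = set0) ?integral_set0//.
  by apply/seteqP; split => y //= []; rewrite !in_itv/=; lra.
have [x1|x1] := ltP x 1.
  rewrite memNset ?mule0 ?adde0; last by rewrite /= in_itv/= => ?; lra.
  rewrite (ltW x1) (_ : _ `&` _ = `[0, x]%classic); last first.
    by apply/seteqP; split => y /=; rewrite !in_itv/=; [case; lra|split; lra].
  rewrite -wicx_FTC ?x0// fineK//.
  exact: integrable_fin_num (wicx_rslope_integrable_itv x1).
rewrite mem_set ?mule1; last by rewrite /= in_itv.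
rewrite (_ : _ `&` _ = `[0, 1[%classic); last first.
  by apply/seteqP; split => y /=; rewrite !in_itv/=; [case; lra|split; lra].
have -> : (if x <= 1 then w x else w 1) = w 1.
  by case: (leP x 1) => // x1'; congr w; lra.
rewrite /wjump EFinB fineK; last exact: integrable_fin_num wicx_rslope_integrable.
rewrite addeC subeK//; exact: integrable_fin_num wicx_rslope_integrable.
Qed.

(** A Lebesgue-Stieltjes measure is determined by its values on the intervals []a, b]], which for
    [nu] are differences of the distribution function found in [nu_cdf]. *)
Let wmeasureE A : measurable A -> wmeasure w A = nu A.
Proof.
apply: (@lebesgue_stieltjes_measure_unique _ _ nu) => _ [[a b]]/= _ <-.
rewrite /lebesgue_stieltjes_measure /measure_extension/=.
rewrite measurable_mu_extE/=; last exact: is_ocitv.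
have [ab | ba] := leP a b; last first.
  by rewrite set_itv_ge ?wlength0 ?measure0// bnd_simp -leNgt ltW.
rewrite wlength_itv_bnd// cumul_of_wext EFinB.
transitivity (nu `]a, b]%classic); last by [].
have := nu_cdf b.
rewrite (_ : `]-oo, b]%classic = `]-oo, a] `|` `]a, b]); last by rewrite -itv_bndbnd_setU.
rewrite measureU//; last first.
  by apply/seteqP; split => y //= []; rewrite !in_itv/=; lra.
move=> E; have {E} : (nu `]-oo, a]%classic + nu `]a, b]%classic = (wext w b)%:E)%E := E.
by rewrite nu_cdf => <-; rewrite [X in (X - _)%E]addeC addeK.
Qed.

(** The formula stays in the extended reals because [Qbar Q 1] may be [+oo]. *)
Lemma int_dwE Q : measurable_fun I Q ->
  int_dw Q w = (\int[mu]_(x in I) (Q x * rslope w x)%:E + (wjump w)%:E * Qbar Q 1)%E.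
Proof.
move=> mQ.
have -> : int_dw Q w = (\int[wmeasure w]_(x in I `|` [set 1%R]) Qbar Q x)%E.
  rewrite /int_dw /I01c; congr (\int[_]_(x in _) _)%E.
  apply/seteqP; split => y /=; rewrite !in_itv/=.
    by move=> /andP[y0]; rewrite le_eqVlt => /predU1P[->|y1]; [right|left; rewrite y0].
  by case => [/andP[-> /ltW]//|->]; rewrite ler01 lexx.
have QE : {in I, (EFin \o Q) =1 Qbar Q}.
  by move=> x; rewrite inE/= in_itv/= => /andP[_ x1]; rewrite /Qbar x1.
have mQb : measurable_fun I (Qbar Q).
  by apply: (eq_measurable_fun (EFin \o Q)) => //; exact/measurable_EFinP.
rewrite integral_setU//; last 2 first.
- apply/measurable_funU => //; split => //.
  by apply: (eq_measurable_fun (cst (Qbar Q 1))) => // x; rewrite inE => ->.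
- apply/disj_setPS => y [/=]; rewrite in_itv/= => /andP[_ +] y1; rewrite y1 ltxx//.
congr (_ + _)%E.
  rewrite (@eq_measure_integral _ _ _ _ nu1); last first.
    move=> A mA AI; transitivity (nu A); first exact: wmeasureE.
    rewrite nuE diracE memNset ?mule0 ?adde0//.
    by move=> /AI/=; rewrite in_itv/= ltxx andbF.
  rewrite integral_density//; apply: eq_integral => x Ix.
  by rewrite -QE// /h patchE Ix.
rewrite (eq_integral (cst (Qbar Q 1))); last by move=> x; rewrite inE => ->.
rewrite integral_cst// muleC; congr (_ * _)%E.
transitivity (nu [set 1]); first exact: wmeasureE.
rewrite nuE diracE mem_set// mule1 nu1E.
rewrite (_ : _ `&` _ = set0) ?integral_set0 ?add0e//.
by apply/seteqP; split => y //= [->]; rewrite in_itv/= ltxx andbF.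
Qed.

End wicx.

(** * Concave envelopes *)

Section superlevel.
Context {R : realType}.
Notation mu := (@lebesgue_measure R).
Notation I := (`[0, 1[%classic : set R).

Lemma ler_linear_perturbation (X Y k tau : R) : 0 < tau ->
  (forall t, 0 < t < tau -> X <= Y + k * t) -> X <= Y.
Proof.
move=> tau0 XY; rewrite leNgt; apply/negP => YX.
pose K := `|k| + 1; have K0 : 0 < K by rewrite ltr_wpDl.
have kK : k <= K by rewrite (le_trans (ler_norm k))// lerDl.
pose t := Num.min (tau / 2) ((X - Y) / (2 * K)).
have t0 : 0 < t by rewrite lt_min !divr_gt0 ?subr_gt0 ?mulr_gt0.
have tt : t < tau by rewrite gt_min; apply/orP; left; lra.
have tX : t * (2 * K) <= X - Y by rewrite -ler_pdivlMr ?mulr_gt0// ge_min lexx orbT.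
have := XY t; rewrite t0 tt => /(_ isT).
nra.
Qed.

(** A superlevel set of a monotone [g] is empty or an interval up to 1 starting at its infimum [c].
    Whether it contains [c] does not affect the integral; the bounds on both sides of [c] are kept
    for locating contact points of the envelope. *)
Lemma superlevelP (g f : R -> R) u :
  {in `[0, 1[ &, {homo g : x y / x <= y}} -> mu.-integrable I (EFin \o f) ->
  (\int[mu]_(x in I `&` [set x | u < g x]) f x = 0 /\
     forall s, 0 <= s < 1 -> g s <= u) \/
  exists c, [/\ 0 <= c < 1, (forall s, 0 <= s < c -> g s <= u),
    (forall s, c < s < 1 -> u < g s) &
    \int[mu]_(x in I `&` [set x | u < g x]) f x = \int[mu]_(x in `[c, 1[) f x].
Proof.
move=> ndg intf; set A := I `&` [set x | u < g x].
have [/eqP A0|/set0P[a Aa]] := boolP (A == set0).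
  left; split; first by rewrite A0 Rintegral_set0.
  move=> s s01; rewrite leNgt; apply/negP => us.
  by have : A s by []; rewrite A0.
have Alb : has_inf A.
  by split; [exists a|exists 0 => x [/=]; rewrite in_itv/= => /andP[]].
right; exists (inf A).
have cge0 : 0 <= inf A.
  by apply: lb_le_inf; [exists a|move=> x [/=]; rewrite in_itv/= => /andP[]].
have [/=] := Aa; rewrite in_itv/= => /andP[a0 a1] ua.
have c1 : inf A < 1 by rewrite (le_lt_trans _ a1)// ge_inf//; case: Alb.
have below s : 0 <= s < inf A -> g s <= u.
  move=> /andP[s0 sc]; rewrite leNgt; apply/negP => us.
  have : inf A <= s.
    apply: ge_inf; first by case: Alb.
    by split => //=; rewrite in_itv/= s0 (lt_trans sc c1).
  by rewrite leNgt sc.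
have above s : inf A < s < 1 -> u < g s.
  move=> /andP[cs s1]; have [b [/= bI ub] bs] := inf_lt Alb.1 cs.
  apply: (lt_le_trans ub); apply: ndg => //; last exact: ltW.
  by rewrite in_itv/= s1 andbT (le_trans cge0)// ltW.
split => //; first by rewrite cge0.
have subI : `]inf A, 1[ `<=` I.
  by apply: subset_itvr; rewrite bnd_simp.
have [uc|uc] := ltP u (g (inf A)).
  congr (Rintegral _ _ _); apply/seteqP; split => x.
    move=> Ax; have [/=] := Ax; rewrite !in_itv/= => /andP[_ ->] _; rewrite andbT.
    by apply: ge_inf => //; case: Alb.
  rewrite /= in_itv/= => /andP[cx x1]; split => /=.
    by rewrite in_itv/= x1 (le_trans cge0).
  by apply: (lt_le_trans uc); apply: ndg => //; rewrite in_itv/= ?cge0// x1 (le_trans cge0).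
rewrite -Rintegral_itv_obnd_cbnd; last exact: integrableS intf.
congr (Rintegral _ _ _); apply/seteqP; split => x.
  move=> Ax; have [/=] := Ax; rewrite !in_itv/= => /andP[_ ->] ux; rewrite andbT.
  rewrite lt_neqAle ge_inf ?andbT//; last by case: Alb.
  by apply/eqP => cx; move: uc; rewrite cx leNgt ux.
rewrite /= in_itv/= => /andP[cx x1]; split => /=; last by apply: above; rewrite cx.
by rewrite in_itv/= x1 (le_trans cge0)// ltW.
Qed.

End superlevel.

(** * Slopes, endpoints and contact points of the envelope *)

Section envelope.
Context {R : realType}.
Notation mu := (@lebesgue_measure R).
Notation I := (`[0, 1[%classic : set R).
Variables (H : R -> R) (C : R).
Hypothesis H0 : H 0 = 0.
Hypothesis Hcont : forall c, 0 < c < 1 -> {for c, continuous H}.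
Hypothesis HC0 : forall s, 0 <= s <= 1 -> H s <= C * s.
Hypothesis HC1 : forall s, 0 <= s <= 1 -> H s <= H 1 + C * (1 - s).

Notation E := (concave_envelope H).
Let dom := [set g : R -> R | concave_on01 g /\ {in `[0, 1], forall x, H x <= g x}].

Lemma affine_concave (k b : R) : concave_on01 (fun x => k * x + b).
Proof. by move=> x y t _ _ _; rewrite le_eqVlt; apply/orP; left; apply/eqP; ring. Qed.

(** This line and the next one majorize [H] and meet it at 0 and at 1 respectively. They make the
    family of majorants nonempty and pin the envelope at both ends. *)
Let dom0 : dom (fun x => C * x + 0).
Proof.
split; first exact: affine_concave.
by move=> x; rewrite in_itv/= addr0; exact: HC0.
Qed.

Let dom1 : dom (fun x => (- C) * x + (H 1 + C)).
Proof.
split; first exact: affine_concave.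
by move=> x; rewrite in_itv/= => /HC1; lra.
Qed.

Let hi s : 0 <= s <= 1 -> has_inf [set g s | g in dom].
Proof.
move=> s01; split; first by exists (C * s + 0), (fun x => C * x + 0).
by exists (H s) => _ /= [g [_ gH] <-]; apply: gH; rewrite in_itv.
Qed.

Lemma envelope_ge s : 0 <= s <= 1 -> H s <= E s.
Proof.
move=> s01; apply: lb_le_inf; first exact: (hi s01).1.
by move=> _ /= [g [_ gH] <-]; apply: gH; rewrite in_itv.
Qed.

Lemma envelope_le g s : concave_on01 g -> (forall x, 0 <= x <= 1 -> H x <= g x) ->
  0 <= s <= 1 -> E s <= g s.
Proof.
move=> cg gH s01; apply: ge_inf; first exact: (hi s01).2.
by exists g => //; split => // x; rewrite in_itv; exact: gH.
Qed.

Lemma envelope_concave : concave_on01 E.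
Proof.
move=> x y t x01 y01 t01; apply: lb_le_inf.
  by apply: (hi _).1; nra.
move=> _ /= [g dg <-]; have [cg gH] := dg.
apply: le_trans (cg x y t x01 y01 t01); have /andP[t0 t1] := t01.
apply: lerD; apply: ler_wpM2l; rewrite ?subr_ge0//.
- by apply: ge_inf; [exact: (hi x01).2|exists g].
- by apply: ge_inf; [exact: (hi y01).2|exists g].
Qed.

Lemma envelope_le_slope0 s : 0 <= s <= 1 -> E s <= C * s.
Proof. by move=> s01; apply: (ge_inf (hi s01).2); exists (fun x => C * x + 0); rewrite ?addr0. Qed.

Lemma envelope_le_slope1 s : 0 <= s <= 1 -> E s <= H 1 + C * (1 - s).
Proof.
move=> s01; apply: (ge_inf (hi s01).2); exists (fun x => - C * x + (H 1 + C)) => //.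
ring.
Qed.

Lemma envelope0 : E 0 = 0.
Proof.
have h : (0 : R) <= (0 : R) <= (1 : R) by rewrite lexx ler01.
by have := envelope_le_slope0 h; have := envelope_ge h; rewrite H0; lra.
Qed.

Lemma envelope1 : E 1 = H 1.
Proof.
have h : (0 : R) <= (1 : R) <= (1 : R) by rewrite lexx ler01.
by have := envelope_le_slope1 h; have := envelope_ge h; lra.
Qed.

Notation phi := (fun x => - E x).
Notation D := (rslope phi).

Lemma opp_envelope_convex : convex_on01 phi.
Proof. by move=> x y t h1 h2 h3; have := envelope_concave h1 h2 h3; lra. Qed.

Lemma opp_envelope_lb s : 0 <= s <= 1 -> phi 0 - C * s <= phi s.
Proof. by move=> /envelope_le_slope0; rewrite envelope0; lra. Qed.

Let sub := rslope_subgradient opp_envelope_convex opp_envelope_lb.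
Let inc := rslope_increment opp_envelope_convex opp_envelope_lb.

Lemma env_rslope_nondecreasing : {in `[0, 1[ &, {homo D : x y / x <= y}}.
Proof. exact: rslope_nondecreasing opp_envelope_convex opp_envelope_lb. Qed.

(** [rslope_increment] stops before 1. At 1 the lower bound is the subgradient inequality at [s],
    and the upper one comes from the affine majorant through [H 1]. *)
Lemma env_increment1 s : 0 <= s < 1 -> D s * (1 - s) <= phi 1 - phi s <= C * (1 - s).
Proof.
move=> s01; apply/andP; split.
  by have := @sub s 1 s01; rewrite ler01 lexx => /(_ isT); lra.
rewrite /= envelope1; have h : 0 <= s <= 1 by lra.
by have := envelope_le_slope1 h; lra.
Qed.

Lemma env_rslope_bounded s : 0 <= s < 1 -> - C <= D s <= C.
Proof.
move=> s01; have /andP[s0 s1] := s01; apply/andP; split; last first.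
  have /andP[h1 h2] := env_increment1 s01.
  by rewrite -(@ler_pM2r _ (1 - s)) ?subr_gt0// (le_trans h1 h2).
apply: (@le_trans _ _ (D 0)); last first.
  by apply: env_rslope_nondecreasing; rewrite ?in_itv/= ?lexx ?ltr01 ?s0.
apply: lb_le_inf.
  by exists ((phi 1 - phi 0) / (1 - 0)), 1 => //=; rewrite in_itv/= ltr01 lexx.
move=> _ /= [y + <-]; rewrite in_itv/= => /andP[y0 y1].
rewrite subr0 ler_pdivlMr//.
by have := @opp_envelope_lb y; rewrite (ltW y0) y1 => /(_ isT); lra.
Qed.

(** The right-hand side isolates the gap [E s - H s]: it is what remains of the integral of [D] once
    that of [H'] is added. *)
Lemma env_FTC s : 0 <= s <= 1 -> \int[mu]_(x in `[s, 1[) D x = H s - H 1 + (E s - H s).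
Proof.
(* At 1 the infimum defining [D] ranges over the empty set. Replacing that value by the upper bound
   [C] keeps monotonicity on the closed interval. *)
move=> /andP[s0 s1]; pose D1 x := if x < 1 then D x else C.
have ndD1 : {in `[s, 1] &, {homo D1 : x y / x <= y}}.
  move=> x y; rewrite !in_itv/= /D1 => /andP[x0 x1] /andP[y0 y1] xy.
  case: (ltP x 1) => hx; case: (ltP y 1) => hy //; last lra.
    by apply: env_rslope_nondecreasing; rewrite ?in_itv/= ?hx ?hy ?andbT//; lra.
  by have /andP[] : - C <= D x <= C by apply: env_rslope_bounded; rewrite hx andbT; lra.
transitivity (\int[mu]_(x in `[s, 1]) D1 x).
  rewrite -Rintegral_itv_bndo_bndc; last first.
    apply: integrableS (nondecreasing_integrable ndD1) => //.
    by apply: subset_itvl; rewrite bnd_simp.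
  by apply: eq_Rintegral => x; rewrite inE/= in_itv/= /D1 => /andP[_ ->].
rewrite (@nondecreasing_FTC _ _ phi)//; first by rewrite envelope1; ring.
move=> x y sx xy y1; rewrite /D1; case: (ltP y 1) => hy.
  by rewrite (le_lt_trans xy hy); apply: inc => //; lra.
have yE : y = 1 by lra.
rewrite yE in xy *.
case: (ltP x 1) => hx; first by apply: env_increment1; rewrite hx andbT; lra.
have -> : x = 1 by lra.
by rewrite !subrr !mulr0 lexx.
Qed.

(** Nothing bounds [D c] by [u], so the increment is taken up to [c - t], the last piece is bounded
    by [D c * t], and [t] tends to 0. *)
Let left_bound x c u : 0 <= x -> x < c -> c < 1 ->
  (forall s, 0 <= s < c -> D s <= u) -> phi c - phi x <= u * (c - x).
Proof.
move=> x0 xc c1 Du; apply: (@ler_linear_perturbation _ _ _ (D c - u) (c - x)); first lra.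
move=> t /andP[t0 tx].
have /andP[_ h1] : D x * (c - t - x) <= phi (c - t) - phi x <= D (c - t) * (c - t - x).
  by apply: inc; lra.
have /andP[_ h2] : D (c - t) * (c - (c - t)) <= phi c - phi (c - t) <= D c * (c - (c - t)).
  by apply: inc; lra.
have h3 : D (c - t) <= u by apply: Du; lra.
have h4 : D (c - t) * (c - t - x) <= u * (c - t - x) by rewrite ler_wpM2r//; lra.
nra.
Qed.

Lemma env_right_increment c x u : 0 <= c -> c < x -> x < 1 ->
  (forall s, c < s < 1 -> u < D s) -> u * (x - c) <= phi x - phi c.
Proof.
move=> c0 cx x1 Du; apply: (@ler_linear_perturbation _ _ _ (u - D c) (x - c)); first lra.
move=> t /andP[t0 tx].
have /andP[h1 _] : D (c + t) * (x - (c + t)) <= phi x - phi (c + t) <= D x * (x - (c + t)).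
  by apply: inc; lra.
have /andP[h2 _] : D c * (c + t - c) <= phi (c + t) - phi c <= D (c + t) * (c + t - c).
  by apply: inc; lra.
have h3 : u < D (c + t) by apply: Du; lra.
have h4 : u * (x - (c + t)) <= D (c + t) * (x - (c + t)) by rewrite ler_wpM2r ?(ltW h3)//; lra.
nra.
Qed.

(** Strictness comes from the right half of [[c, x]]: at its left end, the midpoint, the slope
    exceeds [u] strictly. *)
Let right_bound c x u : 0 <= c -> c < x -> x < 1 ->
  (forall s, c < s < 1 -> u < D s) -> u * (x - c) < phi x - phi c.
Proof.
move=> c0 cx x1 Du; pose s := (c + x) / 2.
have h1 : u * (s - c) <= phi s - phi c by apply: env_right_increment => //; rewrite /s; lra.
have /andP[h2 _] : D s * (x - s) <= phi x - phi s <= D x * (x - s) by apply: inc; rewrite /s; lra.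
have h3 : u < D s by apply: Du; rewrite /s; lra.
have h4 : u * (x - s) < D s * (x - s) by rewrite ltr_pM2r//; rewrite /s; lra.
nra.
Qed.

(* Where the slope of the envelope changes, the envelope touches [H]: otherwise
   replacing it near [c] by a chord gives a smaller concave majorant. *)
Lemma envelope_contact c u : 0 <= c < 1 -> (forall s, 0 <= s < c -> D s <= u) ->
  (forall s, c < s < 1 -> u < D s) -> E c = H c.
Proof.
move=> /andP[c0 c1] Dl Dr.
have [->|cn0] := eqVneq c 0; first by rewrite envelope0.
have {c0 cn0} c0 : 0 < c by rewrite lt_neqAle eq_sym cn0.
have c01 : 0 <= c <= 1 by lra.
apply/eqP; rewrite eq_le envelope_ge// andbT leNgt; apply/negP => HE.
pose e := (E c - H c) / 2; have e0 : 0 < e by rewrite /e; lra.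
have /cvgrPdist_lt/(_ e e0)/nbhs_ballP[d /= d0 hd] : H x @[x --> c] --> H c.
  by apply: Hcont; rewrite c0.
pose K := `|E c| + `|E 1| + 1.
have K0 : 0 < K by rewrite /K ltr_wpDl// addr_ge0.
(* [t] is small enough that [E] loses less than [e] at the points [x1] and [x2] below, and that both
   lie within [d] of [c], where [H < H c + e = E c - e]. *)
pose t := Num.min (2^-1) (Num.min (e / (2 * K)) (d / 2)).
have t0 : 0 < t.
  rewrite !lt_min; apply/andP; split; first by rewrite invr_gt0.
  by apply/andP; split; apply: divr_gt0 => //; rewrite mulr_gt0.
have t1 : t <= 2^-1 by rewrite ge_min lexx.
have te : t * (2 * K) <= e by rewrite -ler_pdivlMr ?mulr_gt0// !ge_min lexx orbT.
have td : t < d by apply: (@le_lt_trans _ _ (d / 2)); [rewrite !ge_min lexx !orbT|lra].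
have /andP[hE1 hE2] : - `|E c| <= E c <= `|E c| by rewrite -ler_norml.
have /andP[hF1 hF2] : - `|E 1| <= E 1 <= `|E 1| by rewrite -ler_norml.
(* These points move [c] towards 0 and towards 1 by the fraction [t], so concavity with the endpoint
   values of [E] bounds [E] from below there. *)
pose x1 := (1 - t) * c; pose x2 := (1 - t) * c + t.
have x1c : x1 < c by rewrite /x1; nra.
have cx2 : c < x2 by rewrite /x2; nra.
have x10 : 0 <= x1 by rewrite /x1 mulr_ge0//; lra.
have x21 : x2 < 1 by rewrite /x2; nra.
have x1d : c - x1 < d by rewrite /x1; nra.
have x2d : x2 - c < d by rewrite /x2; nra.
have Ex1 : E c - e < E x1.
  have h01 : (0 : R) <= (0 : R) <= (1 : R) by rewrite lexx ler01.
  have ht : 0 <= t <= 1 by lra.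
  have := envelope_concave c01 h01 ht; rewrite envelope0 !mulr0 !addr0 -/x1.
  have : t * E c <= t * K by rewrite ler_wpM2l ?(ltW t0)// /K; have := normr_ge0 (E 1); lra.
  by have := mulr_gt0 t0 K0; lra.
have Ex2 : E c - e < E x2.
  have h01 : (0 : R) <= (1 : R) <= (1 : R) by rewrite lexx ler01.
  have ht : 0 <= t <= 1 by lra.
  have := envelope_concave c01 h01 ht; rewrite !mulr1 -/x2.
  have : t * (E c - E 1) <= t * K by rewrite ler_wpM2l ?(ltW t0)// /K; lra.
  by have := mulr_gt0 t0 K0; lra.
pose sg := (E x2 - E x1) / (x2 - x1).
have x12 : 0 < x2 - x1 by lra.
have sgE : sg * (x2 - x1) = E x2 - E x1 by rewrite /sg divfK ?gt_eqF.
pose l x := sg * x + (E x1 - sg * x1).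
have lE x : l x * (x2 - x1) = (x2 - x) * E x1 + (x - x1) * E x2.
  transitivity (sg * (x2 - x1) * (x - x1) + E x1 * (x2 - x1)); first by rewrite /l; ring.
  by rewrite sgE; ring.
(* Outside [[x1, x2]] the chord [l] lies above the concave [E]; inside it stays above [E c - e],
   which exceeds [H]. *)
have lH x : 0 <= x <= 1 -> H x <= l x.
  move=> x01; have /andP[x0 x1'] := x01.
  have three := @convex_on01_three_points _ phi _ _ _ opp_envelope_convex.
  have [xx1|x1x] := ltP x x1.
    apply: (le_trans (envelope_ge x01)).
    have := three x x1 x2 x0; rewrite (lt_trans xx1)//; last lra.
    have -> : x <= x1 <= x2 by lra.
    have -> : x2 <= 1 by lra.
    move=> /(_ isT isT isT) h3; rewrite -(ler_pM2r x12) lE; lra.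
  have [x2x|xx2] := ltP x2 x.
    apply: (le_trans (envelope_ge x01)).
    have := three x1 x2 x x10; rewrite (lt_trans _ x2x)//; last lra.
    have -> : x1 <= x2 <= x by lra.
    rewrite x1' => /(_ isT isT isT) h3; rewrite -(ler_pM2r x12) lE; lra.
  have Hx : H x < E c - e.
    have : ball c d x by rewrite /ball/= ltr_norml; lra.
    by move=> /hd/=; rewrite ltr_norml /e; lra.
  apply/ltW/(lt_trans Hx).
  rewrite -(ltr_pM2r x12) lE.
  have [->|xn] := eqVneq x x2; first by rewrite subrr mul0r add0r mulrC ltr_pM2l.
  have xx2' : x < x2 by rewrite lt_neqAle xn.
  have h1 : (x2 - x) * (E c - e) < (x2 - x) * E x1 by rewrite ltr_pM2l// subr_gt0.
  have h2 : (x - x1) * (E c - e) <= (x - x1) * E x2 by rewrite ler_wpM2l ?subr_ge0 ?(ltW Ex2).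
  lra.
have cmin : concave_on01 (fun x => Num.min (E x) (l x)).
  move=> x y s hx hy hs; rewrite le_min; have /andP[s0 s1] := hs; apply/andP; split.
    apply: le_trans (envelope_concave hx hy hs).
    by apply: lerD; apply: ler_wpM2l; rewrite ?subr_ge0// ge_min lexx.
  rewrite /l; apply: le_trans (affine_concave sg (E x1 - sg * x1) hx hy hs).
  by apply: lerD; apply: ler_wpM2l; rewrite ?subr_ge0// ge_min lexx orbT.
have : E c <= Num.min (E c) (l c).
  apply: (envelope_le (g := fun x => Num.min (E x) (l x))) => //.
  by move=> x x01; rewrite le_min envelope_ge// lH.
rewrite le_min => /andP[_].
(* The slope of [- E] is at most [u] before [c] and more than [u] after it, so the chord passes
   strictly below [E c], against the minimality of [E]. *)
have h1 := left_bound x10 x1c c1 Dl.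
have h2 := right_bound (ltW c0) cx2 x21 Dr.
rewrite leNgt => /negP; apply; rewrite -(ltr_pM2r x12) lE.
have h3 : (x2 - c) * (E x1 - E c) <= (x2 - c) * (u * (c - x1)) by rewrite ler_pM2l; lra.
have h4 : (c - x1) * (E x2 - E c) < (c - x1) * (- (u * (x2 - c))) by rewrite ltr_pM2l; lra.
nra.
Qed.

End envelope.

(** * Quantile functions *)

Section upper_quantile.
Context {d : measure_display} {T : measurableType d} {R : realType}.
Variables (P : probability T R) (X : T -> R) (m : R).
Hypothesis mX : measurable_fun setT X.
Hypothesis Xm : {ae P, forall w, m <= X w}.
Notation mu := (@lebesgue_measure R).
Notation I := (`[0, 1[%classic : set R).
Notation Q := (upper_quantile P X).
Notation F x := (fine (P [set w | X w <= x])).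

Let mXle x : measurable [set w | X w <= x].
Proof. by rewrite -preimage_itvNyc -[X in measurable X]setTI; apply: mX => //; exact: measurable_itv. Qed.

Let F_below x : x < m -> F x = 0.
Proof.
move=> xm; have [N [mN N0 XN]] := Xm.
have -> : P [set w | X w <= x] = 0%E.
  apply/eqP; rewrite eq_le measure_ge0 andbT -N0 le_measure ?inE//.
  move=> w /= Xx; apply: XN => /= mXw.
  by have := le_lt_trans (le_trans mXw Xx) xm; rewrite ltxx.
by [].
Qed.

Let F_to1 s : s < 1 -> exists x, s < F x.
Proof.
move=> s1.
pose X' : {RV P >-> R} := mfun_Sub (mem_set mX).
have XE x : F x = fine (cdf X' x).
  by rewrite /cdf /distribution /pushforward /= -preimage_itvNyc.
have /fine_cvgP[_ /cvgrPdist_lt/(_ (1 - s))] := cvg_cdfy1 X'.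
rewrite subr_gt0 => /(_ s1) h.
near (pinfty_nbhs R) => x; exists x; rewrite XE.
have : `|1 - (fine \o cdf X') x| < 1 - s by near: x.
by rewrite /= => /(le_lt_trans (ler_norm _)); lra.
Unshelve. all: by end_near. Qed.

Let has_inf_quantile s : 0 <= s < 1 -> has_inf [set x | s < F x].
Proof.
move=> /andP[s0 s1]; split; first by have [x] := F_to1 s1; exists x.
exists m => x /= sF; rewrite leNgt; apply/negP => /F_below F0.
by move: sF; rewrite F0 ltNge s0.
Qed.

Lemma upper_quantile_ge s : 0 <= s < 1 -> m <= Q s.
Proof.
move=> s01; have /andP[s0 _] := s01; apply: lb_le_inf; first exact: (has_inf_quantile s01).1.
move=> x /= sF; rewrite leNgt; apply/negP => /F_below F0.
by move: sF; rewrite F0 ltNge s0.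
Qed.

Lemma upper_quantile_le s x : 0 <= s < 1 -> s < F x -> Q s <= x.
Proof. by move=> s01 sF; apply: ge_inf => //; exact: (has_inf_quantile s01).2. Qed.

Lemma upper_quantile_nondecreasing : {in `[0, 1[ &, {homo Q : x y / x <= y}}.
Proof.
move=> x y; rewrite !in_itv/= => x01 y01 xy; apply: lb_le_inf.
  exact: (has_inf_quantile y01).1.
by move=> z /= yF; apply: upper_quantile_le => //; exact: le_lt_trans yF.
Qed.

Lemma upper_quantile_le_bound M s : {ae P, forall w, X w <= M} -> 0 <= s < 1 -> Q s <= M.
Proof.
move=> [N [mN N0 XN]] s01; apply: upper_quantile_le => //.
suff -> : P [set w | X w <= M] = 1%E by case/andP: s01.
have h : P (~` [set w | X w <= M]) = 0%E.
  apply/eqP; rewrite eq_le measure_ge0 andbT -N0 le_measure ?inE//.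
  exact: measurableC.
by have := probability_setC P (measurableC (mXle M)); rewrite setCK h sube0.
Qed.

(** The function [Q (1 - s) ^+ 2] under the uniform law has tails no larger than those of [X ^+ 2]
    under [P]; integrating the tails compares the expectations. *)
Lemma upper_quantile_square_lty : 0 <= m -> P.-integrable setT (fun w => (X w ^+ 2)%:E) ->
  (\int[mu]_(s in I) ((Q (1 - s)) ^+ 2)%:E < +oo)%E.
Proof.
move=> m0 intX2.
pose Y (s : measurableTypeR R) : R := if 0 < s < 1 then Q (1 - s) ^+ 2 else 0.
have mQ : measurable_fun (`]0, 1[%classic : set R) (fun s => Q (1 - s)).
  have : measurable_fun (`]0, 1[%classic : set R) (fun s => - Q (1 - s)).
    apply: nondecreasing_itv_measurable => x y; rewrite !in_itv/= => x01 y01 xy.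
    by rewrite lerN2; apply: upper_quantile_nondecreasing; rewrite ?in_itv/=; lra.
  move=> /measurable_funN; congr measurable_fun; apply/funext => s /=.
  by rewrite opprK.
have mY : measurable_fun (setT : set (measurableTypeR R)) Y.
  have -> : Y = (fun s => Q (1 - s) ^+ 2) \_ `]0, 1[.
    apply/funext => s; rewrite patchE /Y.
    by case: ifPn => s01; [rewrite mem_set|rewrite memNset//= in_itv; exact/negP].
  apply/(measurable_restrictT _ (measurable_itv _)).
  exact: measurable_funX.
have mX2 : measurable_fun setT (fun w => X w ^+ 2) by exact: measurable_funX.
pose U : probability (measurableTypeR R) R := uniform_prob (@ltr01 R).
pose Y' : {RV U >-> R} := mfun_Sub (mem_set mY).
pose X' : {RV P >-> R} := mfun_Sub (mem_set mX2).
have EY := @ge0_expectation_ccdf _ _ _ U Y'.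
have EX := @ge0_expectation_ccdf _ _ _ P X' (fun w => sqr_ge0 _).
have Y0 s : 0 <= Y s by rewrite /Y; case: ifP => // _; exact: sqr_ge0.
(* With [y] the square root of [r]: if [Q (1 - s) ^+ 2 > r] then [Q (1 - s) > y], hence
   [s <= 1 - F y]. The set of such [s] has measure at most [1 - F y], the probability that
   [X > y]. *)
have le_ccdf r : 0 <= r -> (ccdf Y' r <= ccdf X' r)%E.
  move=> r0; rewrite /ccdf /distribution /pushforward/=.
  pose y := Num.sqrt r.
  pose A := [set w | X w <= y]; pose B := [set w | r < X w ^+ 2].
  have mA : measurable A by exact: mXle.
  have tail : (1 - P A <= P B)%E.
    rewrite -probability_setC// le_measure ?inE//.
    - exact: measurableC.
    - by rewrite /B -preimage_itvoy -[X in measurable X]setTI; exact: (mX2 measurableT _ (measurable_itv _)).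
    move=> w /= /negP; rewrite -ltNge /B/= => yX.
    by rewrite -(sqr_sqrtr r0) ltrXn2r// ?nnegrE ?sqrtr_ge0.
  rewrite preimage_itvoy preimage_itvoy; apply: le_trans tail.
  have U_mu G : measurable G -> (U G <= mu G)%E.
    move=> mG; rewrite -[leRHS]mul1e -integral_cst//; apply: ge0_le_integral => //.
    - by move=> x _; rewrite lee_fin uniform_pdf_ge0.
    - by apply: measurable_funTS; apply/measurable_EFinP; exact: measurable_uniform_pdf.
    - by move=> x _; rewrite lee_fin /uniform_pdf subr0 invr1; case: ifP.
  have F1 : F y <= 1 by rewrite -lee_fin fineK ?fin_num_measure// probability_le1.
  apply: (@le_trans _ _ (U `[0, 1 - F y]%classic)).
    apply: le_measure; rewrite ?inE.
    - by rewrite -preimage_itvoy -[X in measurable X]setTI; exact: (mY measurableT _ (measurable_itv _)).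
    - exact: measurable_itv.
    move=> s /=; rewrite /Y; case: ifPn => [/andP[s0 s1] rQ|_]; last by rewrite ltNge r0.
    rewrite in_itv/= (ltW s0)/= lerBrDr -lerBrDl leNgt; apply/negP => sF.
    have s01 : 0 <= 1 - s < 1 by lra.
    have := upper_quantile_le s01 sF; have := upper_quantile_ge s01 => mQ' Qy.
    move: rQ; rewrite ltNge => /negP; apply; rewrite -(sqr_sqrtr r0) ler_sqr ?nnegrE ?sqrtr_ge0//.
    exact: le_trans m0 mQ'.
  apply: (le_trans (U_mu _ (measurable_itv _))).
  rewrite lebesgue_measure_itv/= lte_fin; case: ifPn => [_|_].
    by rewrite sube0 EFinB fineK ?fin_num_measure.
  by rewrite -[X in (_ - X)%E]fineK ?fin_num_measure// lee_fin subr_ge0.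
have : ('E_U[Y'] < +oo)%E.
  have EXoo : ('E_P[X'] < +oo)%E.
    rewrite expectation_def; move/integrableP : intX2 => [_]; congr (_ < _)%E.
    by apply: eq_integral => w _; rewrite gee0_abs// lee_fin sqr_ge0.
  rewrite EY//; apply: le_lt_trans EXoo.
  rewrite EX; apply: ge0_le_integral => //.
  - by apply: measurable_funTS; exact: ccdf_measurable.
  - by apply: measurable_funTS; exact: ccdf_measurable.
  - by move=> r; rewrite /= in_itv/= andbT; exact: le_ccdf.
rewrite expectation_def integral_uniform//; last exact/measurable_EFinP.
rewrite subr0 invr1 mul1e integral_itv_bndoo; last first.
  by apply/measurable_EFinP; exact: measurable_funTS.
rewrite [X in _ -> (X < _)%E]integral_itv_bndoo; last first.
  by apply/measurable_EFinP; exact: measurable_funX.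
congr (_ < _)%E; apply: eq_integral => s; rewrite inE/= in_itv/= => s01.
by rewrite /Y s01.
Qed.

End upper_quantile.

(** * The optimal weight *)

Section integration_on_itv.
Context {R : realType}.
Notation mu := (@lebesgue_measure R).
Notation I := (`[0, 1[%classic : set R).

Lemma Rintegral_itvoo_le (f : R -> R) s t M : s <= t ->
  mu.-integrable `]s, t[ (EFin \o f) ->
  (forall x, s < x < t -> f x <= M) ->
  \int[mu]_(x in `]s, t[) f x <= M * (t - s).
Proof.
move=> st intf fM.
have -> : M * (t - s) = \int[mu]_(x in `]s, t[) M.
  have -> := @Rintegral_cst _ _ _ mu `]s, t[ (measurable_itv _) M.
  have := @lebesgue_measure_itv R `]s, t[; rewrite /= lte_fin => ->.
  case: ltP => [_|ts]; first by rewrite -EFinB.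
  by rewrite (@le_anti _ _ s t) ?subrr ?mulr0// st ts.
apply: le_Rintegral => //.
  by apply: (@bounded_integrable _ _ _ `|M|) => //; exact: lebesgue_itv_lty.
Qed.

Lemma integrable_itv_bndo_bndc (a : itv_bound R) (b : R) (f : R -> R) :
  mu.-integrable [set` Interval a (BLeft b)] (EFin \o f) ->
  mu.-integrable [set` Interval a (BRight b)] (EFin \o f).
Proof.
move=> /integrableP[mf foo].
have mf' : measurable_fun [set` Interval a (BRight b)] (EFin \o f).
  exact/emeasurable_fun_itv_bndo_bndcP.
apply/integrableP; split => //.
rewrite -integral_itv_bndo_bndc//.
by apply: measurableT_comp.
Qed.

Lemma ae_eq_Rintegral (D : set (measurableTypeR R)) (f g : R -> R) : measurable D ->
  measurable_fun D f -> measurable_fun D g ->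
  {ae mu, forall x, D x -> f x = g x} ->
  \int[mu]_(x in D) f x = \int[mu]_(x in D) g x.
Proof.
move=> mD mf mg fg; congr fine; apply: ae_eq_integral => //.
- exact/measurable_EFinP.
- exact/measurable_EFinP.
by apply: filterS fg => x fg Dx /=; rewrite fg.
Qed.

Lemma ae_le_Rintegral (f g : R -> R) :
  mu.-integrable I (EFin \o f) -> mu.-integrable I (EFin \o g) ->
  {ae mu, forall x, I x -> f x <= g x} ->
  \int[mu]_(x in I) f x <= \int[mu]_(x in I) g x.
Proof.
move=> intf intg fg; have intd := integB intg intf.
rewrite -subr_ge0 -RintegralB//.
rewrite (@ae_eq_Rintegral _ _ (fun x => `|g x - f x|))//.
- by rewrite Rintegral_ge0.
- exact: integ_measurable intd.
- exact: integ_measurable (integrable_norm intd).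
case: fg => N [mN N0 fgN]; exists N; split => // x nP; apply: fgN => /= fg; apply: nP => Ix.
by rewrite ger0_norm// subr_ge0; exact: fg.
Qed.

(** The hypothesis makes [g p] a subgradient at [p]; averaging the two supporting inequalities at
    [x] and [y] cancels the linear term. *)
Lemma convex_of_increments (g w : R -> R) :
  (forall s t, 0 <= s -> s <= t -> t <= 1 ->
     g s * (t - s) <= w t - w s <= g t * (t - s)) -> convex_on01 w.
Proof.
move=> inc x y t /andP[x0 x1] /andP[y0 y1] /andP[t0 t1].
set p := (1 - t) * x + t * y.
have p0 : 0 <= p by rewrite /p; nra.
have p1 : p <= 1 by rewrite /p; nra.
have sub z : 0 <= z -> z <= 1 -> w p + g p * (z - p) <= w z.
  move=> z0 z1; have [pz|/ltW zp] := leP p z.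
    by have /andP[h _] := inc p z p0 pz z1; lra.
  by have /andP[_ h] := inc z p z0 zp p1; lra.
have hx := sub x x0 x1; have hy := sub y y0 y1.
have h1 : (1 - t) * (w p + g p * (x - p)) <= (1 - t) * w x by rewrite ler_wpM2l// subr_ge0.
have h2 : t * (w p + g p * (y - p)) <= t * w y by rewrite ler_wpM2l.
apply: le_trans (lerD h1 h2).
rewrite le_eqVlt; apply/orP; left; apply/eqP; rewrite /p; ring.
Qed.

End integration_on_itv.

Section optimal_weight.
Context {R : realType}.
Notation mu := (@lebesgue_measure R).
Notation I := (`[0, 1[%classic : set R).
Variables (H : R -> R) (C : R).
Hypothesis H0 : H 0 = 0.
Hypothesis HC0 : forall s, 0 <= s <= 1 -> H s <= C * s.
Hypothesis HC1 : forall s, 0 <= s <= 1 -> H s <= H 1 + C * (1 - s).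
Hypothesis C0 : 0 <= C.

Notation E := (concave_envelope H).
Notation phi := (fun x => - E x).
Notation D := (rslope phi).

(** [D] is the right derivative of the convex function [- E], so this is the positive part of minus
    the slope of the envelope. *)
Definition gstar s := Num.max 0 (D s).

Lemma gstar_ge0 s : 0 <= gstar s. Proof. by rewrite le_max lexx. Qed.

Lemma gstar_le s : 0 <= s < 1 -> gstar s <= C.
Proof. by move=> s01; rewrite ge_max C0; have /andP[] := env_rslope_bounded H0 HC0 HC1 s01. Qed.

Lemma gstar_nondecreasing : {in `[0, 1[ &, {homo gstar : x y / x <= y}}.
Proof.
move=> x y hx hy xy; rewrite /gstar.
have := env_rslope_nondecreasing H0 HC0 hx hy xy.
move=> h; rewrite ge_max le_max lexx/= le_max h orbT//.
Qed.

Lemma gstar_measurable : measurable_fun I gstar.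
Proof. exact: nondecreasing_itv_measurable gstar_nondecreasing. Qed.

Lemma gstar_sqint : sqint gstar.
Proof.
apply: (@sqint_bounded _ _ C); first exact: gstar_measurable.
by move=> x /=; rewrite in_itv/= => /gstar_le; rewrite ger0_norm// gstar_ge0.
Qed.

Lemma optimal_weight : exists ws : R -> R, [/\ in_Wicx ws,
  {within `[0, 1], continuous ws}, wjump ws = 0,
  (forall s, 0 <= s < 1 -> is_rderiv ws s (gstar s)) &
  (forall s, 0 <= s < 1 -> rslope ws s = gstar s)].
Proof.
have inc s t := rslope_increment (opp_envelope_convex HC0) (opp_envelope_lb H0 HC0) (x := s) (y := t).
(* [c] is where the slope of [- E] becomes positive. It is located by [superlevelP] with a zero
   integrand; [c = 1] if the slope is never positive. *)
have [c [/andP[c0 c1] Dl Dr]] : exists c, [/\ 0 <= c <= 1,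
    (forall s, 0 <= s < c -> D s <= 0) & (forall s, c < s < 1 -> 0 < D s)].
  have int0 : mu.-integrable I (EFin \o (fun=> 0 : R)) by exact: (integrable0 _ _).
  have [[_ Dl]|[c [c01 Dl Dr _]]] :=
    superlevelP 0 (env_rslope_nondecreasing H0 HC0) int0.
    by exists 1; split => // [|s /andP[s1 s2]]; [rewrite lexx ler01|lra].
  by exists c; split => //; case/andP: c01 => -> /ltW.
have phi_nd s t : c <= s -> s <= t -> t <= 1 -> phi s <= phi t.
  have lt1 s' t' : c <= s' -> s' < t' -> t' < 1 -> phi s' <= phi t'.
    move=> cs st t1.
    have : 0 * (t' - s') <= phi t' - phi s'.
      apply: (env_right_increment H0 HC0) => //; first exact: le_trans cs.
      by move=> x /andP[sx x1]; apply: Dr; rewrite x1 (le_lt_trans cs sx).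
    by rewrite mul0r subr_ge0.
  move=> cs; rewrite le_eqVlt => /predU1P[->//|st].
  rewrite le_eqVlt => /predU1P[t1|]; last exact: lt1.
  rewrite t1 in st *; pose m := (s + 1) / 2.
  have sm : phi s <= phi m by apply: lt1 => //; rewrite /m; lra.
  apply: (le_trans sm).
  have m01 : 0 <= m < 1 by rewrite /m; lra.
  have /andP[h _] := env_increment1 H0 HC0 HC1 m01.
  have Dm : 0 < D m by apply: Dr; rewrite /m; lra.
  have : 0 <= D m * (1 - m) by rewrite mulr_ge0 ?(ltW Dm)//; rewrite /m; lra.
  by move=> /le_trans/(_ h); rewrite subr_ge0.
(* The weight is [- E] frozen on [[0, c]] and shifted to start at 0, so its increments are inherited
   from the envelope. *)
pose W s := phi (Num.max s c) - phi c.
pose g1 s := if s < 1 then gstar s else C.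
have g1_ge0 s : 0 <= g1 s by rewrite /g1; case: ifP => // _; exact: gstar_ge0.
have Wl s : s <= c -> W s = 0 by move=> sc; rewrite /W max_r// subrr.
have Wr s : c <= s -> W s = phi s - phi c by move=> sc; rewrite /W max_l.
have incr s t : c <= s -> s <= t -> t <= 1 -> g1 s * (t - s) <= phi t - phi s <= g1 t * (t - s).
  move=> cs st t1; have nd := phi_nd _ _ cs st t1.
  rewrite /g1; have [s1|s1] := ltP s 1; last first.
    have sE : s = t by lra.
    by rewrite -sE !subrr !mulr0 lexx.
  have s01 : 0 <= s < 1 by rewrite s1 (le_trans c0).
  have [t1'|t1'] := ltP t 1.
    have /andP[h1 h2] := inc s t (le_trans c0 cs) st t1'.
    apply/andP; split.
      by rewrite /gstar; case: (leP 0 (D s)) => // _; rewrite mul0r subr_ge0.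
    by apply: (le_trans h2); rewrite ler_wpM2r ?subr_ge0// le_max lexx orbT.
  have tE : t = 1 by lra.
  rewrite tE in nd *; have /andP[h1 h2] := env_increment1 H0 HC0 HC1 s01.
  apply/andP; split; last exact: h2.
  by rewrite /gstar; case: (leP 0 (D s)) => // _; rewrite mul0r subr_ge0.
have incW s t : 0 <= s -> s <= t -> t <= 1 -> g1 s * (t - s) <= W t - W s <= g1 t * (t - s).
  move=> s0 st t1; have [cs|sc] := leP c s.
    rewrite !Wr ?(le_trans cs st)//; have := incr s t cs st t1.
    by rewrite opprB addrA subrK.
  rewrite (Wl s (ltW sc)) subr0.
  have g1s : g1 s = 0.
    rewrite /g1 (lt_le_trans sc c1) /gstar max_l//; apply: Dl; by rewrite s0.
  rewrite g1s mul0r; have [ct|tc] := leP c t; last first.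
    by rewrite (Wl t (ltW tc)) lexx/= mulr_ge0// subr_ge0.
  rewrite Wr// subr_ge0 phi_nd//=; have /andP[_ h] := incr c t (lexx c) ct t1.
  by apply: (le_trans h); rewrite ler_wpM2l// lerD2l lerN2 ltW.
have ndW s t : 0 <= s -> s <= t -> t <= 1 -> W s <= W t.
  move=> s0 st t1; have /andP[h _] := incW s t s0 st t1.
  by rewrite -subr_ge0 (le_trans _ h)// mulr_ge0// subr_ge0.
have W0 : W 0 = 0 by rewrite Wl.
have WW : in_Wicx W.
  split => //.
  - by move=> x y; rewrite !in_itv/= => /andP[x0 _] /andP[_ y1] xy; exact: ndW.
  - exact: convex_of_increments incW.
  - by move=> s; rewrite in_itv/= => /andP[s0 s1]; rewrite -W0; exact: ndW.
have ndg1 : {in `[0, 1] &, {homo g1 : x y / x <= y}}.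
  move=> x y; rewrite !in_itv/= /g1 => /andP[x0 x1] /andP[y0 y1] xy.
  case: (ltP x 1) => hx; case: (ltP y 1) => hy //; last lra.
    by apply: gstar_nondecreasing; rewrite ?in_itv/= ?x0 ?y0.
  by apply: gstar_le; rewrite x0.
have WE s : 0 <= s <= 1 -> \int[mu]_(x in `[0, s]) g1 x = W s.
  move=> /andP[s0 s1]; rewrite (@nondecreasing_FTC _ _ W)// ?W0 ?subr0//.
    by move=> x y; rewrite !in_itv/= => x01 y01; apply: ndg1; rewrite in_itv/=; lra.
  by move=> x y x0 xy ys; apply: incW => //; exact: le_trans s1.
have Wrd s : 0 <= s < 1 -> is_rderiv W s (gstar s).
  move=> /andP[s0 s1]; have [cs|sc] := leP c s.
    have -> : gstar s = D s.
      (* [Dr] does not cover [s = c]. There [D s >= 0] holds because all chords from [s] rise, [- E]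
         being nondecreasing on [[c, 1]]. *)
      rewrite /gstar max_r//; apply: lb_le_inf.
        by exists ((phi 1 - phi s) / (1 - s)), 1 => //=; rewrite in_itv/= s1 lexx.
      move=> _ /= [y + <-]; rewrite in_itv/= => /andP[sy y1].
      by rewrite divr_ge0 ?subr_ge0 ?(ltW sy)//; apply: phi_nd => //; exact: ltW.
    have s01 : 0 <= s < 1 by rewrite s0.
    have := rslope_is_rderiv (opp_envelope_convex HC0) (opp_envelope_lb H0 HC0) s01.
    apply: cvg_trans; apply: near_eq_cvg; near=> h.
    have h0 : 0 < h by near: h; exact: nbhs_right_gt.
    have csh : c <= s + h by rewrite (le_trans cs)// lerDl ltW.
    by rewrite (Wr _ cs) (Wr _ csh) opprB addrA subrK.
  have -> : gstar s = 0 by rewrite /gstar max_l//; apply: Dl; rewrite s0.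
  rewrite /is_rderiv; apply: cvg_near_cst; near=> h.
  have h0 : 0 < h by near: h; exact: nbhs_right_gt.
  have hc : h < c - s by near: h; apply: nbhs_right_lt; rewrite subr_gt0.
  rewrite !Wl; [by rewrite subrr mulr0|exact: ltW|lra].
have Wlb s : 0 <= s <= 1 -> W 0 - 0 * s <= W s.
  by case/andP => s0 s1; rewrite mul0r subr0; exact: ndW.
have Wsl s : 0 <= s < 1 -> rslope W s = gstar s.
  move=> s01; have cW : convex_on01 W by case: WW.
  have := rslope_is_rderiv cW Wlb s01; have := Wrd s s01.
  rewrite /is_rderiv => h1 h2; exact: (cvg_unique _ h2 h1).
exists W; split => //.
- have := parameterized_integral_continuous ler01 (nondecreasing_integrable ndg1).
  apply: subspace_eq_continuous => x; rewrite inE/= in_itv/= => x01.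
  exact: WE.
- rewrite /wjump -WE ?ler01 ?lexx//.
  have intg1 : mu.-integrable `[0, 1[ (EFin \o g1).
    apply: integrableS (nondecreasing_integrable ndg1) => //.
    by apply: subset_itvl; rewrite bnd_simp.
  rewrite -Rintegral_itv_bndo_bndc//; apply/eqP; rewrite subr_eq0; apply/eqP.
  apply: eq_Rintegral => x; rewrite inE/= in_itv/= => x01.
  by rewrite Wsl// /g1; case/andP: x01 => _ ->.
Unshelve. all: by end_near. Qed.

End optimal_weight.

(** * Orthogonality of the residual *)

Section isotonic_data.
Context {R : realType}.
Notation mu := (@lebesgue_measure R).
Notation I := (`[0, 1[%classic : set R).
Variables (Q0 Qr : R -> R) (B0 beta lambda : R).
Hypothesis ndQ0 : {in `[0, 1[ &, {homo Q0 : x y / x <= y}}.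
Hypothesis Q0B : forall s, 0 <= s < 1 -> `|Q0 s| <= B0.
Hypothesis ndQr : {in `[0, 1[ &, {homo Qr : x y / x <= y}}.
Hypothesis Qr_ge0 : forall s, 0 <= s < 1 -> 0 <= Qr s.
Hypothesis Qr_sq : (\int[mu]_(s in I) ((Qr (1 - s)) ^+ 2)%:E < +oo)%E.
Hypothesis lambda0 : 0 < lambda.

Definition unconstrained s := beta - lambda / 2 * Qr (1 - s).
Notation a := unconstrained.

(** The interval is open at 0 because [a 0] involves [Qr 1], about which [ndQr] says nothing. *)
Lemma unconstrained_nondecreasing : {in `]0, 1[ &, {homo a : x y / x <= y}}.
Proof.
move=> x y; rewrite !in_itv/= => x01 y01 xy; rewrite /a lerD2l lerN2.
by rewrite ler_pM2l ?divr_gt0//; apply: ndQr; rewrite ?in_itv/=; lra.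
Qed.

Lemma unconstrained_le s : 0 < s < 1 -> a s <= beta.
Proof.
move=> s01; rewrite /a lerBlDr lerDl mulr_ge0 ?divr_ge0 ?(ltW lambda0)//.
by apply: Qr_ge0; lra.
Qed.

Lemma reflected_sqint : sqint (fun s => Qr (1 - s)).
Proof.
have mr : measurable_fun I (fun s => Qr (1 - s)).
  apply/measurable_fun_itv_obnd_cbndP.
  have : measurable_fun (`]0, 1[%classic : set R) (fun s => - Qr (1 - s)).
    apply: nondecreasing_itv_measurable => x y; rewrite !in_itv/= => x01 y01 xy.
    by rewrite lerN2; apply: ndQr; rewrite ?in_itv/=; lra.
  move=> /measurable_funN; congr measurable_fun; apply/funext => s /=.
  by rewrite opprK.
split => //; apply/integrableP; split.
  by apply/measurable_EFinP; exact: measurable_funX.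
move: Qr_sq; congr (_ < _)%E; apply: eq_integral => x _.
by rewrite /= ger0_norm// sqr_ge0.
Qed.

Lemma unconstrained_sqint : sqint a.
Proof. by apply: sqintB; [exact: sqint_cst|apply: sqintZ; exact: reflected_sqint]. Qed.

Lemma Q0_sqint : sqint Q0.
Proof.
apply: (@sqint_bounded _ _ B0); first exact: nondecreasing_itv_measurable.
by move=> x /=; rewrite in_itv/=; exact: Q0B.
Qed.

Notation H := (Hfun Q0 Qr beta lambda).
Let hH t := 2 * beta - lambda * Qr (1 - t) - 2 * Q0 t.

Let hHE t : hH t = 2 * (a t - Q0 t).
Proof. by rewrite /hH /a; lra. Qed.

Let int_hH : mu.-integrable I (EFin \o hH).
Proof.
have : mu.-integrable I (EFin \o (fun t => 2 * (a t - Q0 t))).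
  apply: integZ; apply: integB; apply: sqint_integ.
    exact: unconstrained_sqint.
  exact: Q0_sqint.
by congr (integrable _ _ (EFin \o _)); apply/funext => t; rewrite hHE.
Qed.

Let int_hH1 : mu.-integrable `[0, 1] (EFin \o hH).
Proof. exact: integrable_itv_bndo_bndc. Qed.

Lemma Hfun0 : H 0 = 0.
Proof. by rewrite /Hfun set_itv1 Rintegral_set1. Qed.

Let H_increment s t : 0 <= s -> s <= t -> t <= 1 -> H t - H s = \int[mu]_(x in `]s, t[) hH x.
Proof.
move=> s0 st t1; rewrite /Hfun (@Rintegral_itvcc_split _ hH _ s t)//; last first.
  by apply: integrableS int_hH1 => //; apply: subset_itvl; rewrite bnd_simp.
rewrite addrC addKr -Rintegral_itv_bndo_bndc//.
apply: integrableS int_hH1 => //; apply: subset_itv; rewrite bnd_simp//.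
Qed.

Let H_tail c : 0 <= c < 1 -> \int[mu]_(x in `[c, 1[) hH x = H 1 - H c.
Proof.
move=> /andP[c0 c1]; rewrite H_increment ?(ltW c1)// Rintegral_itv_obnd_cbnd//.
by apply: integrableS int_hH1 => //; apply: subset_itv; rewrite bnd_simp.
Qed.

Lemma Hfun_continuous c : 0 < c < 1 -> {for c, continuous H}.
Proof.
move=> c01; have := parameterized_integral_continuous ler01 int_hH1.
by move=> /(continuous_within_itvP _ ltr01)[+ _ _]; apply; rewrite in_itv.
Qed.

(** Near 0 the term [- lambda * Qr (1 - t)] may be unbounded, but its sign only lowers [H']. On
    [[1/2, 1[] it is controlled by [Qr 2^-1], which bounds [H'] from below there. *)
Lemma Hfun_bounds : exists C, [/\ 0 <= C,
  (forall s, 0 <= s <= 1 -> H s <= C * s) &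
  (forall s, 0 <= s <= 1 -> H s <= H 1 + C * (1 - s))].
Proof.
have B00 : 0 <= B0 by apply: le_trans (normr_ge0 (Q0 0)) (Q0B _); rewrite lexx ltr01.
pose A := \int[mu]_(x in I) `|hH x|.
have A0 : 0 <= A by rewrite Rintegral_ge0.
have r0 : 0 <= Qr 2^-1 by apply: Qr_ge0; lra.
have lr0 : 0 <= lambda * Qr 2^-1 by rewrite mulr_ge0// ltW.
have /andP[b1 b2] : - `|beta| <= beta <= `|beta| by rewrite -ler_norml.
have b0 := normr_ge0 beta.
pose C1 := 2 * `|beta| + 2 * B0 + lambda * Qr 2^-1.
have C10 : 0 <= C1 by rewrite /C1; lra.
have subI s t : 0 <= s -> t <= 1 -> `]s, t[ `<=` I.
  by move=> s0 t1; apply: subset_itv; rewrite bnd_simp.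
have Q0b x : 0 <= x < 1 -> - B0 <= Q0 x <= B0 by move=> /Q0B; rewrite ler_norml.
exists (C1 + 2 * A); split; first lra.
  move=> s /andP[s0 s1].
  have := H_increment (lexx 0) s0 s1; rewrite Hfun0 subr0 => ->.
  apply: (@le_trans _ _ (C1 * s)); last by rewrite ler_wpM2r//; lra.
  rewrite -[X in C1 * X]subr0; apply: Rintegral_itvoo_le => //.
    by apply: integrableS int_hH => //; exact: subI.
  move=> x /andP[x0 xs].
  have x01 : 0 <= x < 1 by lra.
  have /andP[q1 q2] := Q0b x x01.
  have : 0 <= lambda * Qr (1 - x) by rewrite mulr_ge0 ?(ltW lambda0)//; apply: Qr_ge0; lra.
  by rewrite /hH /C1; lra.
have half s : 2^-1 <= s -> s <= 1 -> - (C1 * (1 - s)) <= H 1 - H s.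
  move=> s0 s1; rewrite H_increment//; last lra.
  rewrite lerNl -mulN1r -RintegralZl//; last first.
    by apply: integrableS int_hH => //; apply: subI => //; lra.
  apply: Rintegral_itvoo_le => //.
    have := integZ (-1) int_hH; apply: integrableS => //; apply: subI => //; lra.
  move=> x /andP[x0 xs].
  have x01 : 0 <= x < 1 by lra.
  have /andP[q1 q2] := Q0b x x01.
  have : lambda * Qr (1 - x) <= lambda * Qr 2^-1.
    by rewrite ler_pM2l//; apply: ndQr; rewrite ?in_itv/=; lra.
  by rewrite /hH /C1; lra.
(* For [s < 1/2] the loss is at most [C1 / 2 + A], half of [C1 + 2 * A], and [1 - s > 1/2]; hence
   the factor 2 in front of [A]. *)
move=> s /andP[s0 s1]; have [hs|hs] := leP 2^-1 s.
  have := half s hs s1; have : 0 <= A * (1 - s) by rewrite mulr_ge0// subr_ge0.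
  by lra.
have h1 : 2^-1 <= (1 : R) by lra.
have := half 2^-1 (lexx _) h1.
have : - A <= H 2^-1 - H s.
  rewrite H_increment//; [|exact: ltW].
  have intn : mu.-integrable `]s, 2^-1[ (EFin \o hH).
    by apply: integrableS int_hH => //; apply: subI.
  rewrite lerNl; apply: (le_trans (ler_norm _)); rewrite normrN.
  apply: (le_trans (le_normr_Rintegral _ intn)) => //.
  apply: fine_le.
  - by apply: integrable_fin_num => //; exact: integrable_norm.
  - by apply: integrable_fin_num => //; exact: integrable_norm.
  apply: ge0_subset_integral => //.
    by have /integrable_norm/integrableP[] := int_hH.
  exact: subI.
have : 2^-1 * (C1 + 2 * A) <= (1 - s) * (C1 + 2 * A) by rewrite ler_wpM2r//; lra.
by lra.
Qed.

Variable C : R.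
Hypothesis C0 : 0 <= C.
Hypothesis HC0 : forall s, 0 <= s <= 1 -> H s <= C * s.
Hypothesis HC1 : forall s, 0 <= s <= 1 -> H s <= H 1 + C * (1 - s).

Notation g := (gstar H).
Notation D := (rslope (fun x => - concave_envelope H x)).

Definition residual s := a s - Q0 s + g s / 2.
Notation f := residual.

Let sqg : sqint g := gstar_sqint Hfun0 HC0 HC1 C0.

Lemma residual_integ : mu.-integrable I (EFin \o f).
Proof.
apply: integD.
  apply: integB; apply: sqint_integ; [exact: unconstrained_sqint|exact: Q0_sqint].
have := integZ 2^-1 (sqint_integ sqg).
by under [X in EFin \o X]eq_fun do rewrite mulrC.
Qed.

Let f_tail c : 0 <= c < 1 ->
  2 * \int[mu]_(x in `[c, 1[) f x = H 1 - H c + \int[mu]_(x in `[c, 1[) g x.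
Proof.
move=> c01; have /andP[c0 c1] := c01.
have sub : `[c, 1[ `<=` I by apply: subset_itvr; rewrite bnd_simp.
rewrite -H_tail// -RintegralD//; last 2 first.
- exact: integrableS int_hH.
- exact: integrableS (sqint_integ sqg).
rewrite -RintegralZl//; last exact: integrableS residual_integ.
by apply: eq_Rintegral => x _; rewrite hHE /f; lra.
Qed.

Let int_D c : 0 <= c -> mu.-integrable `[c, 1[ (EFin \o D).
Proof.
move=> c0.
have mD : measurable_fun (`[0, 1[%classic : set R) D.
  exact: nondecreasing_itv_measurable (env_rslope_nondecreasing Hfun0 HC0).
have : mu.-integrable I (EFin \o D).
  apply: (@bounded_integrable _ _ _ C) => //; first exact: lebesgue_itv_lty.
  move=> x /=; rewrite in_itv/= => x01; rewrite ler_norml.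
  exact: (env_rslope_bounded Hfun0 HC0 HC1 x01).
by apply: integrableS => //; apply: subset_itvr; rewrite bnd_simp.
Qed.

(** Each layer is a tail [[c, 1[], where [D <= g] turns [env_FTC] into the lower bound [E c - H c].
    The layer formula requires a bounded [gam]. *)
Lemma residual_cone_ge0 (gam : R -> R) N :
  {in `[0, 1[ &, {homo gam : x y / x <= y}} ->
  (forall x, 0 <= x < 1 -> 0 <= gam x <= N) ->
  0 <= \int[mu]_(x in I) (f x * gam x).
Proof.
move=> ndgam gamN; apply: (@Rintegral_layers_ge0 _ _ _ N).
- exact: residual_integ.
- exact: nondecreasing_itv_measurable.
- by move=> x /=; rewrite in_itv/=; exact: gamN.
move=> u u0; have [[-> _]//|[c [c01 _ _ ->]]] := superlevelP u ndgam residual_integ.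
have /andP[c0 c1] := c01.
have c01' : 0 <= c <= 1 by rewrite c0 ltW.
have : 0 <= 2 * \int[mu]_(x in `[c, 1[) f x; last by lra.
rewrite f_tail//.
have : \int[mu]_(x in `[c, 1[) D x <= \int[mu]_(x in `[c, 1[) g x.
  apply: le_Rintegral => //; first exact: int_D.
    apply: integrableS (sqint_integ sqg) => //.
    by apply: subset_itvr; rewrite bnd_simp.
  by move=> x _; rewrite /gstar le_max lexx orbT.
rewrite (env_FTC Hfun0 HC0 HC1 c01'); have := envelope_ge HC0 c01'; lra.
Qed.

Lemma residual_gstar : \int[mu]_(x in I) (f x * g x) = 0.
Proof.
have ndg := gstar_nondecreasing Hfun0 HC0.
have gC x : 0 <= x < 1 -> 0 <= g x <= C.
  by move=> x01; rewrite gstar_ge0 (gstar_le Hfun0 HC0 HC1 C0).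
have ge := residual_cone_ge0 ndg gC.
apply/eqP; rewrite eq_le ge andbT.
have mg : measurable_fun I g by case: sqg.
have intfg : mu.-integrable I (EFin \o (fun x => f x * g x)).
  apply: (integ_le _ _ (integZ C (integrable_norm residual_integ))).
    by apply: measurable_funM => //; exact: integ_measurable residual_integ.
  move=> x /=; rewrite in_itv/= => /gC/andP[g0 gx].
  by rewrite normrM mulrC ler_wpM2r// ger0_norm.
(* The reverse inequality applies the layer formula to [- f]: each superlevel set of [g] at a level
   [u >= 0] starts at a contact point, and beyond it [g = D], so [f] has zero integral on the
   layer. *)
have : 0 <= \int[mu]_(x in I) (((-1) * f x) * g x); last first.
  under eq_Rintegral do rewrite -mulrA.
  by rewrite RintegralZl// mulN1r oppr_ge0.
have intNf := integZ (-1) residual_integ.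
apply: (@Rintegral_layers_ge0 _ (fun x => (-1) * f x) _ C) => //.
move=> u u0; have [[-> _]//|[c [c01 gl gr ->]]] := superlevelP u ndg intNf.
have /andP[c0 c1] := c01.
have sub : `[c, 1[ `<=` I by apply: subset_itvr; rewrite bnd_simp.
have Dl s : 0 <= s < c -> D s <= u.
  by move=> /gl; apply: le_trans; rewrite /gstar le_max lexx orbT.
have gD s : c < s < 1 -> g s = D s /\ u < D s.
  move=> /gr; rewrite /gstar; case: (leP 0 (D s)) => [|_]; first by [].
  by rewrite ltNge u0.
have Dr s : c < s < 1 -> u < D s by move=> /gD[].
have contact := envelope_contact Hfun0 Hfun_continuous HC0 c01 Dl Dr.
have c01' : 0 <= c <= 1 by rewrite c0 ltW.
have gDint : \int[mu]_(x in `[c, 1[) g x = \int[mu]_(x in `[c, 1[) D x.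
  rewrite -Rintegral_itv_obnd_cbnd; last first.
    by apply: integrableS (sqint_integ sqg) => //; apply: subset_itv; rewrite bnd_simp.
  rewrite -[RHS]Rintegral_itv_obnd_cbnd; last first.
    by apply: integrableS (int_D c0) => //; apply: subset_itv; rewrite bnd_simp.
  by apply: eq_Rintegral => x; rewrite inE/= in_itv/= => /gD[].
rewrite RintegralZl//; last exact: integrableS residual_integ.
have := f_tail c01; rewrite gDint (env_FTC Hfun0 HC0 HC1 c01') contact; lra.
Qed.

End isotonic_data.

(** * Values of the dual objective *)

Section dual_value.
Context {R : realType}.
Notation mu := (@lebesgue_measure R).
Notation I := (`[0, 1[%classic : set R).
Notation integ f := (mu.-integrable I (EFin \o f)).
Notation J f := (\int[mu]_(x in I) f x).

Lemma Qset_sqint (Q : R -> R) : in_Qset Q -> sqint Q.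
Proof.
move=> [ndQ _ Q2]; have mQ := nondecreasing_itv_measurable ndQ.
split => //; apply/integrableP; split.
  by apply/measurable_EFinP; exact: measurable_funX.
move: Q2; congr (_ < _)%E; apply: eq_integral => x _.
by rewrite /= ger0_norm// sqr_ge0.
Qed.

Lemma sqint_le (q h : R -> R) : measurable_fun I q ->
  (forall x, I x -> `|q x| <= `|h x|) -> sqint h -> sqint q.
Proof.
move=> mq qh [_ ih]; split => //; apply: (integ_le _ _ ih); first exact: measurable_funX.
move=> x Ix; rewrite normrX -[leRHS]real_normK ?num_real//.
by rewrite lerXn2r ?nnegrE ?qh.
Qed.

Lemma integ_bounded_mul (q h : R -> R) B : measurable_fun I q ->
  (forall x, 0 <= x < 1 -> `|q x| <= B) -> integ h -> integ (fun x => q x * h x).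
Proof.
move=> mq qB ih; apply: (integ_le _ _ (integZ B (integrable_norm ih))).
  by apply: measurable_funM => //; exact: integ_measurable ih.
by move=> x /=; rewrite in_itv/= => /qB qx; rewrite normrM ler_wpM2r.
Qed.

Lemma fine_integral (h : R -> R) : integ h -> (\int[mu]_(x in I) (h x)%:E = (J h)%:E)%E.
Proof. by move=> ih; rewrite /Rintegral fineK//; exact: integrable_fin_num ih. Qed.

Lemma int_dw_integ (Q w : R -> R) : in_Wicx w -> measurable_fun I Q ->
  integ (fun x => Q x * rslope w x) ->
  int_dw Q w = ((J (fun x => Q x * rslope w x))%:E + (wjump w)%:E * Qbar Q 1)%E.
Proof. by move=> Ww mQ iQ; rewrite int_dwE// fine_integral. Qed.

Lemma int_dw_nojump (Q w : R -> R) : in_Wicx w -> measurable_fun I Q ->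
  integ (fun x => Q x * rslope w x) -> wjump w = 0 ->
  int_dw Q w = (J (fun x => Q x * rslope w x))%:E.
Proof. by move=> Ww mQ iQ w0; rewrite int_dw_integ// w0 mul0e adde0. Qed.

Variables (Q0 Qr : R -> R) (B0 beta lambda : R).
Hypothesis ndQ0 : {in `[0, 1[ &, {homo Q0 : x y / x <= y}}.
Hypothesis Q0B : forall s, 0 <= s < 1 -> `|Q0 s| <= B0.
Hypothesis ndQr : {in `[0, 1[ &, {homo Qr : x y / x <= y}}.
Hypothesis Qr_ge0 : forall s, 0 <= s < 1 -> 0 <= Qr s.
Hypothesis Qr_sq : (\int[mu]_(s in I) ((Qr (1 - s)) ^+ 2)%:E < +oo)%E.
Hypothesis lambda0 : 0 < lambda.
Notation H := (Hfun Q0 Qr beta lambda).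
Variable C : R.
Hypothesis C0 : 0 <= C.
Hypothesis HC0 : forall s, 0 <= s <= 1 -> H s <= C * s.
Hypothesis HC1 : forall s, 0 <= s <= 1 -> H s <= H 1 + C * (1 - s).

Notation a := (unconstrained Qr beta lambda).
Notation g := (gstar H).
Notation f := (residual Q0 Qr beta lambda).

Let sq_a : sqint a := unconstrained_sqint beta lambda ndQr Qr_sq.
Let sq_Q0 : sqint Q0 := Q0_sqint ndQ0 Q0B.
Let sq_r := reflected_sqint ndQr Qr_sq.
Let sq_g : sqint g := gstar_sqint (Hfun0 _ _ _ _) HC0 HC1 C0.

(** Completing the square in [Q - a]. The integrals against [w] stay apart because they may be
    infinite. *)
Lemma LagrE Q w : sqint Q ->
  Lagr Q0 Qr Q w beta lambda =
  ((J (fun x => (Q x - a x) ^+ 2 + (beta ^+ 2 - a x ^+ 2)))%:E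
    - (int_dw Q w - int_dw Q0 w))%E.
Proof.
move=> sQ; rewrite /Lagr /I01o; congr (_ - _)%E.
have i1 : integ (fun x => (Q x - beta) ^+ 2) by case: (sqintB sQ (sqint_cst beta)).
have i2 := sqintM sQ sq_r.
rewrite !fine_integral// -EFinM -EFinD -RintegralZl// -RintegralD//; last exact: integZ.
by congr EFin; apply: eq_Rintegral => x _; rewrite /unconstrained; field.
Qed.

(** The minimum over real [q] of [(q - a)^2 + beta^2 - a^2 - (q - Q0) * g] at the point [x],
    attained at [q = a + g / 2]. *)
Definition dual_integrand x := beta ^+ 2 - a x ^+ 2 - a x * g x - g x ^+ 2 / 4 + Q0 x * g x.
Notation v := dual_integrand.
Notation V := (J v).

Let int_a2 : integ (fun x => beta ^+ 2 - a x ^+ 2).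
Proof. by apply: integB; [exact: sqint_integ (sqint_cst _)|case: sq_a]. Qed.

Lemma dual_integrand_integ : integ v.
Proof.
have ig2 : integ (fun x => g x ^+ 2 / 4).
  have := integZ 4^-1 (proj2 sq_g).
  by under [X in EFin \o X]eq_fun do rewrite mulrC.
apply: integD (sqintM sq_Q0 sq_g); apply: integB ig2.
exact: integB int_a2 (sqintM sq_a sq_g).
Qed.

Let int_sq Q : sqint Q -> integ (fun x => (Q x - a x) ^+ 2 + (beta ^+ 2 - a x ^+ 2)).
Proof. by move=> sQ; apply: integD int_a2; case: (sqintB sQ sq_a). Qed.

Lemma dual_obj_ge ws : in_Wicx ws -> wjump ws = 0 ->
  (forall s, 0 <= s < 1 -> rslope ws s = g s) ->
  (V%:E <= dual_obj Q0 Qr beta lambda ws)%E.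
Proof.
move=> Ww w0 wg; apply: le_ereal_inf_tmp => _ [Q /Qset_sqint sQ <-].
have dwE q : sqint q -> int_dw q ws = (J (fun x => q x * g x))%:E.
  move=> sq; rewrite int_dw_nojump//.
  - congr EFin; apply: eq_Rintegral => x; rewrite inE/= in_itv/= => x01.
    by rewrite wg.
  - by case: sq.
  - have := sqintM sq sq_g; apply: eq_integrable => // x; rewrite inE/= in_itv/= => x01.
    by rewrite /= wg.
have iQ := sqintM sQ sq_g; have iQ0 := sqintM sq_Q0 sq_g.
have iS := int_sq sQ.
rewrite LagrE// !dwE// -!EFinB lee_fin -RintegralB// -RintegralB//; last exact: integB.
apply: le_Rintegral => //.
- exact: dual_integrand_integ.
- by apply: integB => //; exact: integB.
move=> x _; rewrite /dual_integrand; have := sqr_ge0 (Q x - a x - g x / 2); lra.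
Qed.

(* [a] may tend to [-oo] at 0, whereas the members of [in_Qset] are real-valued
   at 0: the unconstrained minimizer has to be truncated from below. *)
Let trunc K x := Num.max (a x) (- K) - a x.

Let trunc_sqint K : sqint (trunc K).
Proof.
apply: sqintB => //; have ma : measurable_fun I a by case: sq_a.
apply: (@sqint_le _ (fun x => `|a x| + `|K|)).
- exact: measurable_maxr.
- move=> x _; have /andP[h1 h2] : - `|a x| <= a x <= `|a x| by rewrite -ler_norml.
  have /andP[h3 h4] : - `|K| <= K <= `|K| by rewrite -ler_norml.
  have h5 := normr_ge0 (a x); have h6 := normr_ge0 K.
  rewrite [X in _ <= X]ger0_norm ?addr_ge0//.
  by rewrite ler_norml le_max ge_max; apply/andP; split; [apply/orP; left|apply/andP; split]; lra.
apply: sqintD; last exact: sqint_cst.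
by apply: (sqint_le _ _ sq_a); [exact: measurableT_comp|move=> x _; rewrite normr_id].
Qed.

(** Dominated convergence with majorant [a ^+ 2]: at a given [x] the truncation vanishes once the
    level exceeds [|a x|]. *)
Let trunc_small e : 0 < e -> exists2 K, 0 <= K & J (fun x => trunc K x ^+ 2) <= e.
Proof.
move=> e0.
have tr_le n x : trunc n%:R x ^+ 2 <= a x ^+ 2.
  rewrite /trunc; have [h|h] := leP (a x) (- n%:R); last by rewrite subrr expr0n/= sqr_ge0.
  by have : 0 <= n%:R :> R := ler0n _ _; nra.
have cvg0 x : (fun n : nat => (trunc n%:R x ^+ 2)%:E) @ \oo --> (0 : \bar R).
  apply: cvg_near_cst; near=> n.
  have : `|a x| < n%:R.
    by near: n; exact: nbhs_infty_gtr.
  rewrite ltr_norml /trunc => /andP[h _].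
  by rewrite max_l ?(ltW h)// subrr expr0n.
have [||||| _ _] := @dominated_convergence _ _ _ mu I (measurable_itv _)
  (fun n x => (trunc n%:R x ^+ 2)%:E) (cst 0%E) (fun x => (a x ^+ 2)%:E).
- move=> n; exact: (measurable_int mu (proj2 (trunc_sqint n%:R))).
- exact: measurable_cst.
- by apply: aeW => x _; exact: cvg0.
- exact: (proj2 sq_a).
- by apply: aeW => x n _; rewrite gee0_abs lee_fin ?sqr_ge0.
rewrite integral_cst// mul0e => /fine_cvgP[_ /cvgrPdist_le/(_ e e0)[n _ h]].
exists n%:R; first exact: ler0n.
have := h n (leqnn n); rewrite /= sub0r normrN; exact/le_trans/ler_norm.
Unshelve. all: by end_near. Qed.

(* Capping the density of [w] at [N] is harmless: where it exceeds [N], the test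
   function [Q] lies above [Q0]. *)
Lemma dual_obj_le w N : in_Wicx w -> wjump w = 0 -> 0 <= N ->
  rslope w 2^-1 <= N -> 2 * (B0 - a 2^-1) <= N ->
  (dual_obj Q0 Qr beta lambda w <=
    (V - J (fun x => (Num.min (rslope w x) N - g x) ^+ 2) / 4)%:E)%E.
Proof.
move=> Ww w0 N0 wN aN.
pose G := rslope w; pose gam x := Num.min (G x) N.
have ndG : {in `[0, 1[ &, {homo G : x y / x <= y}} := wicx_rslope_nondecreasing Ww.
have G0 x : 0 <= x < 1 -> 0 <= G x by exact: wicx_rslope_ge0.
have iG : integ G := wicx_rslope_integrable Ww.
have ndgam : {in `[0, 1[ &, {homo gam : x y / x <= y}}.
  by move=> x y hx hy xy; rewrite /gam le_min !ge_min lexx orbT andbT ndG.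
have gamN x : 0 <= x < 1 -> 0 <= gam x <= N.
  by move=> x01; rewrite le_min G0// N0 ge_min lexx orbT.
have sq_gam : sqint gam.
  apply: (@sqint_bounded _ _ N); first exact: nondecreasing_itv_measurable.
  by move=> x /=; rewrite in_itv/= => /gamN/andP[h1 h2]; rewrite ger0_norm.
have sq_d := sqintB sq_gam sq_g.
have int_f := residual_integ ndQ0 Q0B ndQr Qr_sq C0 HC0 HC1.
have gC x : 0 <= x < 1 -> `|g x| <= C.
  by move=> x01; rewrite ger0_norm ?gstar_ge0//; exact: (gstar_le (Hfun0 _ _ _ _) HC0 HC1 C0 x01).
have gamB x : 0 <= x < 1 -> `|gam x| <= N.
  by move=> /gamN/andP[h1 h2]; rewrite ger0_norm.
have ifg : integ (fun x => f x * g x).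
  have := integ_bounded_mul (proj1 sq_g) gC int_f.
  by under [X in EFin \o X]eq_fun do rewrite mulrC.
have ifgam : integ (fun x => f x * gam x).
  have := integ_bounded_mul (proj1 sq_gam) gamB int_f.
  by under [X in EFin \o X]eq_fun do rewrite mulrC.
apply/lee_addgt0Pr => e e0; have [K K0 Ke] := trunc_small e0.
pose q x := Num.max (a x) (- K) + gam x / 2.
have ndq : {in `]0, 1[ &, {homo q : x y / x <= y}}.
  move=> x y hx hy xy; apply: lerD.
    by rewrite ge_max !le_max lexx orbT andbT (unconstrained_nondecreasing _ ndQr lambda0 hx hy xy).
  rewrite ler_pM2r ?invr_gt0//; apply: ndgam => //.
    by move: hx; rewrite !in_itv/= => /andP[/ltW-> ->].
  by move: hy; rewrite !in_itv/= => /andP[/ltW-> ->].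
have qB x : 0 < x < 1 -> `|q x| <= `|beta| + K + N.
  move=> x01; have x01' : 0 <= x < 1 by case/andP: x01 => /ltW-> ->.
  have /andP[h1 h2] := gamN x x01'.
  have h3 : a x <= beta := unconstrained_le beta Qr_ge0 lambda0 x01.
  have h4 := ler_norm beta; have h5 := normr_ge0 beta.
  have h6 : - K <= Num.max (a x) (- K) by rewrite le_max lexx orbT.
  have h7 : Num.max (a x) (- K) <= `|beta| by rewrite ge_max; apply/andP; split; lra.
  by rewrite ler_norml /q; apply/andP; split; lra.
pose Q := rcv q.
have QQ : in_Qset Q := rcv_in_Qset qB.
have sQ := Qset_sqint QQ.
have QB x : 0 <= x < 1 -> `|Q x| <= `|beta| + K + N by exact: (rcv_bounded qB).
have iQG := integ_bounded_mul (proj1 sQ) QB iG.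
have iQ0G := integ_bounded_mul (proj1 sq_Q0) Q0B iG.
apply: (@le_trans _ _ (Lagr Q0 Qr Q w beta lambda)).
  by apply: ereal_inf_lbound; exists Q.
have iS := int_sq sQ.
rewrite LagrE// !int_dw_nojump//; [|by case: sq_Q0|by case: sQ].
rewrite -!EFinB -EFinD lee_fin -RintegralB// -RintegralB//; last exact: integB.
have iT := proj2 (trunc_sqint K).
have i4 := integZ 4^-1 (proj2 sq_d).
have i12 := integD iT dual_integrand_integ.
have i123 := integB i12 i4.
have i1234 := integB i123 ifgam.
have i12345 := integD i1234 ifg.
(* With [Q = max(a, - K) + gam / 2] this integrand equals [(Q - a)^2 + beta^2 - a^2 - (Q - Q0) *
   gam]: the cross terms in [trunc K] cancel. It remains to replace the true density by [gam]. *)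
apply: (@le_trans _ _ (J (fun x => trunc K x ^+ 2 + v x - 4^-1 * (gam x - g x) ^+ 2
    - f x * gam x + f x * g x))); last first.
  have mI : measurable (I : set (measurableTypeR R)) by exact: measurable_itv.
  rewrite (RintegralD mI i1234 ifg) (RintegralB mI i123 ifgam) (RintegralB mI i12 i4).
  rewrite (RintegralD mI iT dual_integrand_integ) (RintegralZl _ mI (proj2 sq_d)).
  have := residual_cone_ge0 ndQ0 Q0B ndQr Qr_sq C0 HC0 HC1 ndgam gamN.
  rewrite (residual_gstar ndQ0 Q0B ndQr Qr_sq C0 HC0 HC1).
  by move: Ke; rewrite /gam /G; lra.
apply: ae_le_Rintegral => //; first by apply: integB => //; exact: integB.
have := rcv_ae ndq qB; case=> Z [mZ Z0 Zsub]; exists Z; split => // x nP.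
apply: Zsub => /= qx; apply: nP => Ix; have {qx} QE := qx Ix.
have x01 : 0 <= x < 1 by move: Ix; rewrite /= in_itv.
(* The cap acts only beyond [1/2], since the slope there is at most [N]. At such [x],
   [Q x >= a 2^-1 + N / 2 >= B0 >= Q0 x]. *)
have key : (Q x - Q0 x) * gam x <= (Q x - Q0 x) * G x.
  rewrite /gam; have [GN|NG] := leP (G x) N; first by rewrite lexx.
  have x2 : 2^-1 < x.
    rewrite ltNge; apply/negP => x2; move: NG; rewrite ltNge => /negP; apply.
    by apply: le_trans wN; apply: ndG => //; rewrite in_itv/=; lra.
  rewrite ler_wpM2l ?(ltW NG)// subr_ge0 /Q QE /q /gam (min_r (ltW NG)).
  have h1 : a 2^-1 <= a x.
    by apply: (unconstrained_nondecreasing _ ndQr lambda0); rewrite ?in_itv/=; lra.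
  have h2 : a x <= Num.max (a x) (- K) by rewrite le_max lexx.
  have : `|Q0 x| <= B0 by exact: Q0B.
  by rewrite ler_norml => /andP[_]; lra.
have TE : trunc K x = Q x - a x - gam x / 2 by rewrite /Q QE /q /trunc; lra.
rewrite TE /dual_integrand /residual; lra.
Qed.

Let jump_arith (s1 s2 s3 M v0 j b k x : R) : s1 <= M + 2 -> s3 <= s2 ->
  j * x <= j * b -> M + 2 - v0 < j * k ->
  s1 - (s2 + j * (b + k) - (s3 + j * x)) < v0.
Proof. by rewrite mulrDr; lra. Qed.

(* A step of height [n] on [1 - n^-2, 1) costs a bounded amount in L^2 but earns
   [n] times the atom of [w] at 1. *)
Lemma dual_obj_jump w : in_Wicx w -> 0 < wjump w ->
  (dual_obj Q0 Qr beta lambda w < V%:E)%E.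
Proof.
move=> Ww w0; have iG : integ (rslope w) := wicx_rslope_integrable Ww.
(* [M0 + 2] bounds the quadratic part, by [(Q - a)^2 <= 2 * (B0 - a)^2 + 2 * (Q - B0)^2] with the
   last square of integral 1. The height [n] makes the gain [wjump w * n] exceed [M0 + 2 - V]. *)
pose M0 := J (fun x => 2 * (B0 - a x) ^+ 2 + (beta ^+ 2 - a x ^+ 2)).
pose n := 1 + `|(M0 + 2 - V) / wjump w|.
have n1 : 1 <= n by rewrite lerDl.
have n0 : 0 < n by rewrite (lt_le_trans _ n1).
have nJ : M0 + 2 - V < wjump w * n.
  rewrite mulrC -ltr_pdivrMr// (le_lt_trans (ler_norm _))// /n ltrDr//.
pose c := 1 - (n ^+ 2)^-1.
have c1 : c < 1 by rewrite /c ltrBlDr ltrDl invr_gt0 exprn_gt0.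
have c0 : 0 <= c by rewrite /c subr_ge0 invf_le1 ?exprn_gt0// exprn_ege1.
(* The base level [B0] keeps [Q] above [Q0], so the absolutely continuous part of [w] can only lower
   the Lagrangian. *)
pose Q x := if x < c then B0 else B0 + n.
have ndQ x y : x <= y -> Q x <= Q y.
  move=> xy; rewrite /Q; case: (ltP x c) => hx; case: (ltP y c) => hy //; lra.
have B00 : 0 <= B0 by apply: le_trans (normr_ge0 (Q0 0)) (Q0B _); rewrite lexx ltr01.
have QB x : `|Q x| <= B0 + n by rewrite ger0_norm /Q; case: ifP => _; lra.
have mQ : measurable_fun I Q.
  by apply: nondecreasing_itv_measurable => x y _ _; exact: ndQ.
have QQ : in_Qset Q.
  split; first by move=> x y _ _; exact: ndQ.
    move=> s _; apply: cvg_near_cst; rewrite /Q; have [sc|cs] := ltP s c.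
      near=> x; have xc : x < c by near: x; exact: nbhs_right_lt.
      by rewrite xc.
    near=> x; have sx : s < x by near: x; exact: nbhs_right_gt.
    by rewrite ltNge (le_trans cs (ltW sx)).
  have [_ /integrableP[_]] := sqint_bounded mQ (fun x _ => QB x).
  congr (_ < _)%E; apply: eq_integral => x _.
  by rewrite /= ger0_norm// sqr_ge0.
have sQ := Qset_sqint QQ.
apply: (@le_lt_trans _ _ (Lagr Q0 Qr Q w beta lambda)).
  by apply: ereal_inf_lbound; exists Q.
have iQG := integ_bounded_mul mQ (fun x _ => QB x) iG.
have iQ0G := integ_bounded_mul (proj1 sq_Q0) Q0B iG.
have Qb1 : Qbar Q 1 = (B0 + n)%:E.
  rewrite /Qbar ltxx; apply/eqP; rewrite eq_le; apply/andP; split.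
    apply: ge_ereal_sup => _ [s _ <-]; rewrite lee_fin.
    exact: le_trans (ler_norm _) (QB s).
  apply: ereal_sup_ubound; exists c; first by rewrite /= in_itv/= c0.
  by rewrite /Q ltxx.
have [x0 Qb0 x0B] : exists2 x0, Qbar Q0 1 = x0%:E & x0 <= B0.
  rewrite /Qbar ltxx; set S := ereal_sup _.
  have S1 : (S <= B0%:E)%E.
    apply: ge_ereal_sup => _ [s + <-]; rewrite /= in_itv/= lee_fin => /Q0B.
    exact: le_trans (ler_norm _).
  have S2 : ((Q0 0%R)%:E <= S)%E.
    by apply: ereal_sup_ubound; exists 0 => //; rewrite /= in_itv/= lexx ltr01.
  move: S1 S2; case: S => [r| |] //; rewrite lee_fin => h1 h2.
  by exists r.
rewrite LagrE// !int_dw_integ// ?Qb1 ?Qb0; last by case: sq_Q0.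
rewrite -!EFinM -!EFinD lte_fin.
have iS := int_sq sQ.
have ik : integ (fun x => (Q x - B0) ^+ 2).
  by case: (sqintB sQ (sqint_cst B0)).
have iM : integ (fun x => 2 * (B0 - a x) ^+ 2 + (beta ^+ 2 - a x ^+ 2)).
  by apply: integD int_a2; apply: integZ; case: (sqintB (sqint_cst B0) sq_a).
have step1 : J (fun x => (Q x - a x) ^+ 2 + (beta ^+ 2 - a x ^+ 2)) <= M0 + 2.
  have k1 : J (fun x => (Q x - B0) ^+ 2) = 1.
    transitivity (\int[mu]_(x in I `&` `[c, 1[) (n ^+ 2)).
      rewrite Rintegral_mkcondr; apply: eq_Rintegral => x; rewrite inE/= in_itv/= => /andP[_ x1].
      rewrite patchE /Q; case: ltP => xc.
        by rewrite memNset ?subrr ?expr0n//= in_itv/= leNgt xc.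
      by rewrite mem_set/= ?in_itv/= ?xc// addrC addKr.
    rewrite setIidr; last by apply: subset_itvr; rewrite bnd_simp.
    have -> := @Rintegral_cst _ _ _ mu `[c, 1[ (measurable_itv _) (n ^+ 2).
    have := @lebesgue_measure_itv R `[c, 1[; rewrite /= lte_fin c1 => ->.
    by rewrite /= /c; field; rewrite gt_eqF.
  have -> : M0 + 2 = M0 + 2 * J (fun x => (Q x - B0) ^+ 2) by rewrite k1 mulr1.
  rewrite -RintegralZl// -RintegralD//; last exact: integZ.
  apply: le_Rintegral => //; first by apply: integD => //; exact: integZ.
  by move=> x _; have := sqr_ge0 ((Q x - B0) - (B0 - a x)); lra.
have step2 : J (fun x => Q0 x * rslope w x) <= J (fun x => Q x * rslope w x).
  apply: le_Rintegral => // x /=; rewrite in_itv/= => x01.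
  rewrite ler_wpM2r ?(wicx_rslope_ge0 Ww)//.
  apply: (le_trans (ler_norm _)); apply: (le_trans (Q0B x01)).
  by rewrite /Q; case: ifP => _; lra.
have step3 : wjump w * x0 <= wjump w * B0 by rewrite ler_pM2l.
exact: (jump_arith step1 step2 step3 nJ).
Unshelve. all: by end_near. Qed.

End dual_value.

(** * Uniqueness of the maximizer *)

Section maximizer.
Context {R : realType}.
Notation mu := (@lebesgue_measure R).
Notation I := (`[0, 1[%classic : set R).
Notation J f := (\int[mu]_(x in I) f x).

Lemma sqint_ae0 (h : R -> R) : sqint h -> J (fun x => h x ^+ 2) <= 0 ->
  {ae mu, forall x, I x -> h x = 0}.
Proof.
move=> [mh ih] h0.
have int0 : (\int[mu]_(x in I) `|(h x ^+ 2)%:E| = 0)%E.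
  have -> : (\int[mu]_(x in I) `|(h x ^+ 2)%:E| = \int[mu]_(x in I) (h x ^+ 2)%:E)%E.
    by apply: eq_integral => x _; rewrite gee0_abs// lee_fin sqr_ge0.
  rewrite fine_integral//; congr EFin; apply/eqP; rewrite eq_le h0.
  by apply: Rintegral_ge0 => x _; exact: sqr_ge0.
have mh2 : measurable_fun I (fun x => (h x ^+ 2)%:E).
  by apply/measurable_EFinP; exact: measurable_funX.
have [+ _] := ae_eq_integral_abs mu (measurable_itv _) mh2.
move=> /(_ int0)[Z [mZ Z0 sub]]; exists Z; split => // x nP; apply: sub => /= hx; apply: nP => Ix.
by have [/eqP] := hx Ix; rewrite sqrf_eq0 => /eqP.
Qed.

Lemma wicx_eq_of_ae (w1 w2 : R -> R) : in_Wicx w1 -> in_Wicx w2 ->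
  wjump w1 = 0 -> wjump w2 = 0 ->
  {ae mu, forall x, I x -> rslope w1 x = rslope w2 x} ->
  {in `[0, 1], forall s, w1 s = w2 s}.
Proof.
move=> W1 W2 j1 j2 [Z [mZ Z0 sub]] s; rewrite in_itv/= => /andP[s0].
have eqint (A : set R) : A `<=` I -> measurable (A : set (measurableTypeR R)) ->
    \int[mu]_(x in A) rslope w1 x = \int[mu]_(x in A) rslope w2 x.
  move=> AI mA; apply: ae_eq_Rintegral => //.
  - exact: measurable_funS AI (wicx_rslope_measurable W1).
  - exact: measurable_funS AI (wicx_rslope_measurable W2).
  exists Z; split => // x nP; apply: sub => /= hx; apply: nP => /AI; exact: hx.
rewrite le_eqVlt => /predU1P[->|s1].
  move: j1 j2; rewrite /wjump eqint// => /eqP; rewrite subr_eq0 => /eqP -> /eqP.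
  by rewrite subr_eq0 => /eqP ->.
rewrite -(wicx_FTC W1) ?s0// -(wicx_FTC W2) ?s0//; apply: eqint => //.
by move=> x /=; rewrite !in_itv/= => /andP[-> /le_lt_trans ->].
Qed.

Variables (Q0 Qr : R -> R) (B0 beta lambda : R).
Hypothesis ndQ0 : {in `[0, 1[ &, {homo Q0 : x y / x <= y}}.
Hypothesis Q0B : forall s, 0 <= s < 1 -> `|Q0 s| <= B0.
Hypothesis ndQr : {in `[0, 1[ &, {homo Qr : x y / x <= y}}.
Hypothesis Qr_ge0 : forall s, 0 <= s < 1 -> 0 <= Qr s.
Hypothesis Qr_sq : (\int[mu]_(s in I) ((Qr (1 - s)) ^+ 2)%:E < +oo)%E.
Hypothesis lambda0 : 0 < lambda.
Notation H := (Hfun Q0 Qr beta lambda).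
Variable C : R.
Hypothesis C0 : 0 <= C.
Hypothesis HC0 : forall s, 0 <= s <= 1 -> H s <= C * s.
Hypothesis HC1 : forall s, 0 <= s <= 1 -> H s <= H 1 + C * (1 - s).
Variable ws : R -> R.
Hypothesis Wws : in_Wicx ws.
Hypothesis jws : wjump ws = 0.
Hypothesis ws_slope : forall s, 0 <= s < 1 -> rslope ws s = gstar H s.

Notation g := (gstar H).
Notation V := (J (dual_integrand Q0 Qr beta lambda)).

(** A cap meeting the requirements of [dual_obj_le]; the summand [C + 1] puts it strictly above
    [g]. *)
Let bound w := C + 1 + `|rslope w 2^-1| + `|2 * (B0 - unconstrained Qr beta lambda 2^-1)|.

Let dual_le w : in_Wicx w -> wjump w = 0 ->
  (dual_obj Q0 Qr beta lambda w <=
    (V - J (fun x => (Num.min (rslope w x) (bound w) - g x) ^+ 2) / 4)%:E)%E.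
Proof.
move=> Ww jw; have C1 : 0 <= C + 1 by rewrite addr_ge0.
apply: (dual_obj_le ndQ0 Q0B ndQr Qr_ge0 Qr_sq lambda0 C0 HC0 HC1) => //; rewrite /bound.
- by rewrite !addr_ge0.
- by rewrite (le_trans (ler_norm _))// addrAC lerDr addr_ge0.
- by rewrite (le_trans (ler_norm _))// lerDr addr_ge0.
Qed.

Let jump_lt w : in_Wicx w -> 0 < wjump w -> (dual_obj Q0 Qr beta lambda w < V%:E)%E.
Proof. move=> Ww jw; exact: (@dual_obj_jump _ _ _ B0 beta lambda ndQ0 Q0B ndQr Qr_sq w Ww jw). Qed.

Let dual_le_V w : in_Wicx w -> (dual_obj Q0 Qr beta lambda w <= V%:E)%E.
Proof.
move=> Ww; have := wjump_ge0 Ww; rewrite le_eqVlt => /predU1P[/esym jw|jw]; last exact/ltW/jump_lt.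
apply: le_trans (dual_le Ww jw) _; rewrite lee_fin lerBlDr lerDl divr_ge0//.
by apply: Rintegral_ge0 => x _; exact: sqr_ge0.
Qed.

Lemma dual_sup : ereal_sup [set dual_obj Q0 Qr beta lambda w | w in @in_Wicx R] = V%:E.
Proof.
apply/eqP; rewrite eq_le; apply/andP; split.
  by apply: ge_ereal_sup => _ [w Ww <-]; exact: dual_le_V.
apply: (le_trans (dual_obj_ge ndQ0 Q0B ndQr Qr_sq C0 HC0 HC1 Wws jws ws_slope)).
by apply: ereal_sup_ubound; exists ws.
Qed.

Lemma ws_maximizer : dual_maximizer Q0 Qr beta lambda ws.
Proof.
split => //; rewrite dual_sup; apply/eqP; rewrite eq_le dual_le_V//=.
exact: (dual_obj_ge ndQ0 Q0B ndQr Qr_sq C0 HC0 HC1).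
Qed.

Lemma maximizer_unique w : dual_maximizer Q0 Qr beta lambda w ->
  {in `[0, 1], forall s, w s = ws s}.
Proof.
move=> [Ww]; rewrite dual_sup => wV.
have jw : wjump w = 0.
  have := wjump_ge0 Ww; rewrite le_eqVlt => /predU1P[//|/(jump_lt Ww)].
  by rewrite wV ltxx.
have := dual_le Ww jw; rewrite wV lee_fin => hJ.
have gC x : 0 <= x < 1 -> g x <= C by exact: (gstar_le (Hfun0 _ _ _ _) HC0 HC1 C0).
have sqd : sqint (fun x => Num.min (rslope w x) (bound w) - g x).
  apply: sqintB; last exact: (gstar_sqint (Hfun0 _ _ _ _) HC0 HC1 C0).
  have b0 : 0 <= bound w by rewrite /bound !addr_ge0.
  apply: (@sqint_bounded _ _ (bound w)).
    apply: measurable_minr => //; exact: wicx_rslope_measurable.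
  move=> x /=; rewrite in_itv/= => x01; rewrite ger0_norm ?ge_min ?lexx ?orbT//.
  by rewrite le_min wicx_rslope_ge0.
have J0 : J (fun x => (Num.min (rslope w x) (bound w) - g x) ^+ 2) <= 0 by lra.
apply: wicx_eq_of_ae => //.
have [Z [mZ Z0 sub]] := sqint_ae0 sqd J0.
exists Z; split => // x nP; apply: sub => /= hx; apply: nP => Ix.
have x01 : 0 <= x < 1 by move: Ix; rewrite /= in_itv.
have /eqP := hx Ix; rewrite subr_eq0 => /eqP; rewrite ws_slope//.
(* If the cap were active at [x], then [g x] would equal [bound w], which is at least [C + 1]. *)
have [//|bw] := leP (rslope w x) (bound w) => bg.
have := gC x x01; rewrite -bg /bound.
have n1 := normr_ge0 (rslope w 2^-1).
have n2 := normr_ge0 (2 * (B0 - unconstrained Qr beta lambda 2^-1)).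
lra.
Qed.

End maximizer.

(** * Application to the quantile functions of [X0] and [rho] *)

Theorem theorem5p1 (R : realType) (d : measure_display) (Omega : measurableType d)
  (P : probability Omega R) (rho X0 : Omega -> R) :
  prob_complete P -> prob_nonatomic P ->
  measurable_fun setT rho ->
  P.-integrable setT (fun w => (rho w ^+ 2)%:E) ->
  {ae P, forall w, 0 < rho w} ->
  (0 < 'V_P[rho])%E ->
  measurable_fun setT X0 ->
  (exists C : R, {ae P, forall w, `|X0 w| <= C}) ->
  forall beta lambda : R, 0 < lambda ->
  let Q0 := upper_quantile P X0 in
  let Qr := upper_quantile P rho in
  let Hhat := concave_envelope (Hfun Q0 Qr beta lambda) in
  exists wstar : R -> R,
    [/\ dual_maximizer Q0 Qr beta lambda wstar,
        (forall w1, dual_maximizer Q0 Qr beta lambda w1 ->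
           {in `[0, 1], forall s, w1 s = wstar s}),
        (exists D : R -> R,
           (forall s, 0 <= s < 1 ->
              is_rderiv wstar s (D s) /\
              exists h, is_rderiv Hhat s h /\ D s = Num.max 0 (- h)) /\
           (exists M : R, forall s, 0 <= s < 1 -> `|D s| <= M))
      & in_Wicx_c2 wstar].
Proof.
move=> _ _ mrho rho2 rho_gt0 _ mX0 [B0 X0B] beta lambda lambda0 Q0 Qr Hhat.
have X0l : {ae P, forall w, - B0 <= X0 w}.
  case: X0B => N [mN N0 sub]; exists N; split => // w nP; apply: sub => /=.
  by rewrite ler_norml => /andP[].
have X0u : {ae P, forall w, X0 w <= B0}.
  case: X0B => N [mN N0 sub]; exists N; split => // w nP; apply: sub => /= h; apply: nP.
  exact: le_trans (ler_norm _) h.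
have rho_ge0 : {ae P, forall w, 0 <= rho w}.
  case: rho_gt0 => N [mN N0 sub]; exists N; split => // w nP; apply: sub => /= h; apply: nP.
  exact: ltW.
have ndQ0 : {in `[0, 1[ &, {homo Q0 : x y / x <= y}} := upper_quantile_nondecreasing mX0 X0l.
have Q0B s : 0 <= s < 1 -> `|Q0 s| <= B0.
  move=> s01; rewrite ler_norml (upper_quantile_ge mX0 X0l s01)/=.
  exact: (upper_quantile_le_bound mX0 X0l X0u s01).
have ndQr : {in `[0, 1[ &, {homo Qr : x y / x <= y}} := upper_quantile_nondecreasing mrho rho_ge0.
have Qr_ge0 s : 0 <= s < 1 -> 0 <= Qr s by exact: (upper_quantile_ge mrho rho_ge0).
have Qr_sq := upper_quantile_square_lty mrho rho_ge0 (lexx 0) rho2.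
have [C [C0 HC0 HC1]] := Hfun_bounds beta ndQ0 Q0B ndQr Qr_ge0 Qr_sq lambda0.
have [ws [Wws cws jws dws sws]] := optimal_weight (Hfun0 _ _ _ _) HC0 HC1 C0.
pose g := gstar (Hfun Q0 Qr beta lambda).
have gC s : 0 <= s < 1 -> `|g s| <= C.
  by move=> s01; rewrite ger0_norm ?gstar_ge0//; exact: (gstar_le (Hfun0 _ _ _ _) HC0 HC1 C0 s01).
have sq_g : sqint g := gstar_sqint (Hfun0 _ _ _ _) HC0 HC1 C0.
exists ws; split.
- exact: (ws_maximizer ndQ0 Q0B ndQr Qr_ge0 Qr_sq lambda0 C0 HC0 HC1 Wws jws sws).
- exact: (maximizer_unique ndQ0 Q0B ndQr Qr_ge0 Qr_sq lambda0 C0 HC0 HC1 Wws jws sws).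
- exists g; split; last by exists C.
  move=> s s01; split; first exact: dws.
  (* The envelope is concave, so its right derivative is obtained from that of the convex function
     [- Hhat]. *)
  exists (- rslope (fun x => - Hhat x) s); split; last by rewrite opprK.
  have := rslope_is_rderiv (opp_envelope_convex HC0)
    (opp_envelope_lb (Hfun0 _ _ _ _) HC0) s01.
  rewrite /is_rderiv => /cvgN; apply: cvg_trans; apply: near_eq_cvg.
  apply: nearW => h /=; rewrite -mulrN; congr (_ * _).
  by rewrite /GRing.opp/= opprB opprK addrC.
- split => //; exists g; split => //; first by case: sq_g.
  case: sq_g => _ /integrableP[_]; congr (_ < _)%E; apply: eq_integral => x _.
  by rewrite /= ger0_norm// sqr_ge0.
Qed.
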